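(* Let $s\ge 2$ and $n\ge 2$ be integers and let $C\subset\mathbb P^2$ be a smooth plane curve of degree $s(n-1)+3$. Let $X:=v_{n-1}(C)\subset\mathbb P^N$, $N=\binom{n+1}{2}-1$, where $v_{n-1}$ is the $(n-1)$-tuple Veronese embedding of $\mathbb P^2$ (so that $X$ is a projectively normal $s$-subcanonical curve), and let $A=S_X/\langle\eta_1,\eta_2\rangle$ be the corresponding Artinian graded Gorenstein ring, with $\eta_1,\eta_2$ two general linear forms on $\mathbb P^N$. Then the Macaulay polynomial of $A$ is an $(s+2)$-tic (a form of degree $s+2$) of Waring number at most $(n-1)^2$.
   Context: We work over $\mathbb C$. $S_X$ denotes the homogeneous coordinate ring of $X\subset\mathbb P^N$. $s$-subcanonical means $\omega_X\cong\mathcal O_X(s)$. For general $\eta_1,\eta_2$ the ring $A$ is Artinian graded Gorenstein with socle of dimension one; it is a quotient of $T=\mathbb C[\mathbb P^N]/\langle\eta_1,\eta_2\rangle\cong\mathbb C[\partial_0,\dots,\partial_{N-2}]$. Let $T$ act on $\mathbb C[x_0,\dots,x_{N-2}]$ by $\partial_i=\partial/\partial x_i$. By Macaulay's theorem there is a homogeneous form $F\in\mathbb C[x_0,\dots,x_{N-2}]$, unique up to nonzero scalar, whose degree is the socle degree of $A$, with $A=T/F^\perp$, $F^\perp=\{D\in T: D\cdot F=0\}$; $F$ is called the Macaulay polynomial of $A$. The Waring number of a form $F$ of degree $d$ is the minimal $r$ such that $F=\lambda_1\ell_1^d+\dots+\lambda_r\ell_r^d$ with $\lambda_i\in\mathbb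 C^*$ and $\ell_i$ linear forms. *)

(* Defs.v *)
From mathcomp Require Import all_boot all_order all_algebra.
From mathcomp Require Import reals complex mpoly.

Set Implicit Arguments.
Unset Strict Implicit.
Unset Printing Implicit Defensive.

Import GRing.Theory.
Local Open Scope ring_scope.

(* Points of P^N are given by nonzero row vectors of homogeneous coordinates.
   Ideals are Prop-valued predicates on polynomials, and a quotient ring is
   handled through the ideal defining it. *)

Definition monoms (d : nat) : seq 'X_{1..3} :=
  [seq m <- [seq bmnm b | b : 'X_{1..3 < d.+1}] | mdeg m == d].

Lemma mem_monoms d m : (m \in monoms d) = (mdeg m == d).
Proof.
rewrite mem_filter; case: (mdeg m =P d) => //= mdeg_m.
have lt_m : (mdeg m < d.+1)%N by rewrite mdeg_m.
by apply/imageP; exists (BMultinom lt_m).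
Qed.

Lemma uniq_monoms d : uniq (monoms d).
Proof.
by rewrite filter_uniq // map_inj_uniq ?enum_uniq //; apply: val_inj.
Qed.

Lemma size_monoms d : size (monoms d) = 'C(d.+2, 2).
Proof.
transitivity 'C(d + 2, d); last first.
  by rewrite -bin_sub ?leq_addr // addKn addn2.
rewrite -(size_basis 2 d); apply/perm_size/uniq_perm.
- exact: uniq_monoms.
- exact: uniq_basis.
by move=> m; rewrite mem_monoms basis_cover.
Qed.

Section Geometry.
Variable K : fieldType.

(* The plane curve f = 0 in P^2, smooth by the Jacobian criterion (which also
   forces f to be nonzero and reduced). *)
Definition smooth_plane_curve (d : nat) (f : {mpoly K[3]}) : Prop :=
  f \is d.-homog /\
  forall p : 'rV[K]_3, p != 0 -> f.@[p 0] = 0 ->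
    exists j : 'I_3, (f^`M(j)).@[p 0] != 0.

(* The Veronese map of degree d; it lands in P^N when N.+1 = 'C(d.+2, 2), the
   number of monomials (size_monoms), so that the default of nth is not used. *)
Definition veronese (N d : nat) (p : 'rV[K]_3) : 'rV[K]_N.+1 :=
  \row_i ('X_[nth 0%MM (monoms d) i] : {mpoly K[3]}).@[p 0].

(* All homogeneous coordinate vectors of points of v_d(C), C = {f = 0}. *)
Definition veronese_curve (N d : nat) (f : {mpoly K[3]}) (z : 'rV[K]_N.+1) :
    Prop :=
  exists (p : 'rV[K]_3) (c : K),
    [/\ p != 0, f.@[p 0] = 0, c != 0 & z = c *: veronese N d p].

(* The homogeneous ideal I(X); thus S_X = K[z_0, ..., z_N] / I(X). *)
Definition homogeneous_ideal (N : nat) (X : 'rV[K]_N.+1 -> Prop)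
    (g : {mpoly K[N.+1]}) : Prop :=
  forall (k : nat) (z : 'rV[K]_N.+1), X z -> (pihomog mdeg k g).@[z 0] = 0.

Definition linear_form (N : nat) (a : 'rV[K]_N.+1) : {mpoly K[N.+1]} :=
  \sum_i a 0 i *: 'X_i.

(* P holds for every pair of linear forms whose coefficients lie in some
   nonempty principal Zariski open set; such sets are a base of the topology. *)
Definition for_general_pair (N : nat)
    (P : {mpoly K[N.+1]} -> {mpoly K[N.+1]} -> Prop) : Prop :=
  exists2 G : {mpoly K[N.+1 + N.+1]}, G != 0 &
    forall a b : 'rV[K]_N.+1,
      G.@[row_mx a b 0] != 0 -> P (linear_form a) (linear_form b).

End Geometry.

Section Algebra.
Variables (K : fieldType) (m : nat).
Implicit Types (I J : {mpoly K[m]} -> Prop) (F : {mpoly K[m]}).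

Definition is_ideal I : Prop :=
  [/\ I 0, forall g h, I g -> I h -> I (g + h) & forall u g, I g -> I (u * g)].

(* I + <e1, e2> *)
Definition adjoin2 I (e1 e2 g : {mpoly K[m]}) : Prop :=
  exists h u v, I h /\ g = h + u * e1 + v * e2.

(* Descending chain condition in K[x] / J, whose ideals are the ideals of K[x]
   containing J. *)
Definition artinian_quotient J : Prop :=
  forall I : nat -> {mpoly K[m]} -> Prop,
    (forall k, is_ideal (I k)) ->
    (forall k g, J g -> I k g) ->
    (forall k g, I k.+1 g -> I k g) ->
  exists k, forall l, (k <= l)%N -> forall g, I k g -> I l g.

(* The class of g in K[x] / J lies in the socle, i.e. the annihilator of the
   irrelevant ideal. *)
Definition in_socle J (g : {mpoly K[m]}) : Prop := forall i : 'I_m, J ('X_i * g).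

Definition socle_dim1 J : Prop :=
  exists g, [/\ in_socle J g, ~ J g
    & forall h, in_socle J h -> exists c : K, J (h - c *: g)].

Definition artinian_gorenstein J : Prop :=
  [/\ is_ideal J, artinian_quotient J & socle_dim1 J].

(* d is a degree in which the socle of K[x] / J is nonzero; it is the socle
   degree when J is homogeneous and the socle has dimension one. *)
Definition socle_degree J (d : nat) : Prop :=
  exists g, [/\ g \is d.-homog, in_socle J g & ~ J g].

(* D . F, where the variables of D act as partial derivatives. *)
Definition diff_act (D F : {mpoly K[m]}) : {mpoly K[m]} :=
  \sum_(a <- msupp D) D@_a *: F^`M[a].

Definition is_waring_sum (d : nat) F (r : nat) : Prop :=
  exists (lam : 'I_r -> K) (l : 'I_r -> {mpoly K[m]}),
    [/\ forall i, lam i != 0, forall i, l i \is 1.-homog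
      & F = \sum_i lam i *: l i ^+ d].

Definition waring_number (d : nat) F (r : nat) : Prop :=
  is_waring_sum d F r /\ forall r', is_waring_sum d F r' -> (r <= r')%N.

End Algebra.

Section Macaulay.
Variables (K : fieldType) (m k : nat).

(* g |-> g \mPo L induces a graded isomorphism
   K[z_0, ..., z_(m-1)] / <e1, e2> ~= K[d_0, ..., d_(k-1)]. *)
Definition quotient_coords (e1 e2 : {mpoly K[m]}) (L : m.-tuple {mpoly K[k]}) :
    Prop :=
  [/\ forall i, tnth L i \is 1.-homog,
      forall D : {mpoly K[k]}, exists g, g \mPo L = D
    & forall g, g \mPo L = 0 <-> exists u v, g = u * e1 + v * e2].

(* A = K[z] / J, a quotient of T = K[d_0, ..., d_(k-1)] through L; the last
   clause says that F^perp is the kernel of T -> A, i.e. A = T / F^perp. *)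
Definition macaulay_polynomial (J : {mpoly K[m]} -> Prop)
    (L : m.-tuple {mpoly K[k]}) (F : {mpoly K[k]}) : Prop :=
  [/\ F != 0,
      exists2 d, socle_degree J d & F \is d.-homog
    & forall g : {mpoly K[m]}, J g <-> diff_act (g \mPo L) F = 0].

End Macaulay.

(* Main.v *)
(** Put m = n - 1 and let q_i be the form of degree m on P^2 which is the
    pullback of eta_i.  For general eta_1, eta_2 the curves q_1 = q_2 = 0 meet
    in at most m^2 points Gamma, none of them on C = {f = 0}, the forms
    vanishing on Gamma are those of (q_1, q_2), and (q_1, q_2, f) is a complete
    intersection, Gorenstein of socle degree 2 m + deg f - 3 = m (s + 2).  The
    ring A is the m-th Veronese subring of its quotient, so it is Gorenstein of
    socle degree s + 2.  A functional on the forms of degree s + 2 that kills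
    the ideal of A kills the forms vanishing on v_m(Gamma), hence is a linear
    combination of the evaluations at these points; by apolarity an evaluation
    corresponds to the (s + 2)-th power of a linear form. *)

Require Import Defs.
From HB Require Import structures.
From mathcomp Require Import all_boot all_order all_algebra.
From mathcomp Require Import reals complex ssrcomplements mpoly boolp perm separable ring zify.
Set Implicit Arguments.
Unset Strict Implicit.
Unset Printing Implicit Defensive.
Import Order.TTheory GRing.Theory Num.Theory.
Local Open Scope ring_scope.

(** * Homogeneous polynomials *)

(** The socle of [(q_1, q_2, f)] is found by exchange: starting from the residue field, cut out by
    [X_0, X_1, X_2], the linear forms are traded one at a time for [q_1], [q_2] and [f], and trading
    a linear form for a form of degree [d] raises the socle degree by [d - 1]. The regular sequences
    this needs come from [q_1 (0, 0, 1) <> 0] and from the absence of common zeros of [q_1, q_2] on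
    the line [X_0 = 0]. The ideal of Gamma is reached by elimination. Let [rho] be the resultant in
    [y] of the affine equations. For [R] of small degree in [y], Cramer's rule writes [rho R] as a
    combination of [q_1, q_2]; if [R] vanishes on Gamma and [rho] has simple roots, then [rho]
    divides both cofactors and cancels. No intersection multiplicities enter, and [m ^ 2] is a
    degree bound for [rho]. All conditions on the pair thus become nonvanishing of polynomials in
    the coefficients of [eta_1, eta_2], and one explicit pair, two families of [m] lines, shows that
    they can be met. Smoothness of [C] makes [f] squarefree, so that the ideal of [X] is the
    preimage of [(f)]. *)

Lemma mpoly_lin_ind (n : nat) (A : nzRingType) (P : {mpoly A[n]} -> Prop) :
  P 0 -> (forall g h, P g -> P h -> P (g + h)) ->
  (forall c m, P (c *: 'X_[m])) -> forall g, P g.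
Proof.
move=> P0 PD PX g; rewrite [g]mpolyE.
by apply: (big_ind P) => // m _; apply: PX.
Qed.

Section Homogeneous.
Variables (n : nat) (K : fieldType).
Implicit Types (f g h : {mpoly K[n]}).

Lemma dhomog_lin_ind (d : nat) (P : {mpoly K[n]} -> Prop) :
  P 0 -> (forall g h, P g -> P h -> P (g + h)) ->
  (forall c m, mdeg m = d -> P (c *: 'X_[m])) ->
  forall g, g \is d.-homog -> P g.
Proof.
move=> P0 PD PX g /dhomogP hg; rewrite [g]mpolyE big_seq.
by apply: (big_ind P) => // m /hg; apply: PX.
Qed.

Lemma dhomogXU (i : 'I_n) : ('X_i : {mpoly K[n]}) \is 1.-homog.
Proof. by rewrite dhomogX; apply/eqP; exact: mdeg1. Qed.

Lemma dhomogXUn (i : 'I_n) e : ('X_i ^+ e : {mpoly K[n]}) \is e.-homog.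
Proof. by have := dhomogMn e (dhomogXU i); rewrite mul1n. Qed.

Lemma pihomogM_hom (d e : nat) f g : f \is d.-homog ->
  pihomog mdeg (d + e) (g * f) = pihomog mdeg e g * f.
Proof.
move=> hf; elim/mpoly_lin_ind: g => [|g h IHg IHh|c m].
- by rewrite mul0r !raddf0 mul0r.
- by rewrite mulrDl !raddfD /= IHg IHh mulrDl.
have hm : 'X_[m] * f \is (mdeg m + d).-homog by rewrite dhomogM ?dhomogX.
rewrite -scalerAl !linearZ /= -scalerAl; congr (_ *: _).
have [<-|ne] := eqVneq (mdeg m) e.
  by rewrite addnC pihomog_dE // pihomog_dE ?dhomogX.
rewrite (pihomog_ne0 _ hm) ?(@pihomog_ne0 _ _ _ (mdeg m)) ?mul0r ?dhomogX //.
by rewrite addnC eqn_add2l.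
Qed.

Lemma pihomogM_lt (d e : nat) f g : f \is d.-homog -> (e < d)%N ->
  pihomog mdeg e (g * f) = 0.
Proof.
move=> hf lt_ed; elim/mpoly_lin_ind: g => [|g h IHg IHh|c m].
- by rewrite mul0r raddf0.
- by rewrite mulrDl raddfD /= IHg IHh addr0.
have hm : 'X_[m] * f \is (mdeg m + d).-homog by rewrite dhomogM ?dhomogX.
rewrite -scalerAl linearZ /= (pihomog_ne0 _ hm) ?scaler0 //.
by rewrite gtn_eqF // ltn_addl.
Qed.

Lemma meval_scale_homog (d : nat) f (c : K) (v : 'I_n -> K) :
  f \is d.-homog -> f.@[fun i => c * v i] = c ^+ d * f.@[v].
Proof.
elim/dhomog_lin_ind => [|g h IHg IHh|a m Em]; first by rewrite !meval0 mulr0.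
  by rewrite !mevalD IHg IHh mulrDr.
rewrite !mevalZ !mevalX mulrCA; congr (_ * _).
under eq_bigr do rewrite exprMn.
by rewrite big_split /= prodrXr -Em mdegE.
Qed.

Lemma eq_sum_pihomog g :
  g = \sum_(d < (msize g)) pihomog mdeg d g.
Proof. exact: pihomog_partitionE. Qed.

End Homogeneous.

(** Reduction modulo [B] isolates the lowest digit. This is what keeps distinct monomials apart
    under the Kronecker substitution below. *)
Lemma digits_inj (n B : nat) (a b : 'I_n -> nat) :
  (forall i, (a i < B)%N) -> (forall i, (b i < B)%N) ->
  (\sum_i a i * B ^ i = \sum_i b i * B ^ i)%N -> a =1 b.
Proof.
elim: n a b => [|n IHn] a b ha hb; first by move=> _ [].
rewrite !big_ord_recl /= !expn0 !muln1.
have shift c : (\sum_(i < n) c (lift ord0 i) * B ^ bump 0 i =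
    B * \sum_(i < n) c (lift ord0 i) * B ^ i)%N.
  by rewrite big_distrr; apply: eq_bigr => i _ /=; rewrite expnS mulnCA.
rewrite !shift => E.
have B_gt0 : (0 < B)%N by apply: leq_trans (ha ord0).
have E0 : a ord0 = b ord0.
  have := congr1 (modn^~ B) E.
  by rewrite ![(_ ord0 + _)%N]addnC ![(B * _)%N]mulnC !modnMDl !modn_small.
move: E; rewrite E0 => /addnI/eqP.
rewrite eqn_pmul2l // => /eqP E i.
have {}E := IHn _ _ (fun i => ha _) (fun i => hb _) E.
by case: (unliftP ord0 i) => [j ->|->].
Qed.

(** * Nonvanishing values of polynomials in characteristic zero *)

Section NonVanishing.
Variable (K : numFieldType).

Lemma poly_neq0_nonroot (p : {poly K}) : p != 0 -> exists t, p.[t] != 0.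
Proof.
move=> p0; pose s := [seq i%:R : K | i <- iota 0 (size p)].
have s_uniq : uniq s.
  by rewrite map_inj_uniq ?iota_uniq //; apply: mulrIn; apply: oner_neq0.
have [all_root|] := boolP (all (root p) s).
  by have := max_poly_roots p0 all_root s_uniq; rewrite size_map size_iota ltnn.
by case/allPn => t _; exists t.
Qed.

(* Kronecker substitution X_i := t ^ (B ^ i), injective on monomials with
   exponents below B. *)
Lemma mpoly_neq0_nonroot (n : nat) (p : {mpoly K[n]}) :
  p != 0 -> exists v, p.@[v] != 0.
Proof.
move=> p0; pose B := msize p.
pose pow (m : 'X_{1..n}) := (\sum_(i < n) m i * B ^ i)%N.
pose q : {poly K} := \sum_(m <- msupp p) p@_m *: 'X^(pow m).
have m_lt m i : m \in msupp p -> (m i < B)%N.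
  by move/msize_mdeg_lt; apply: leq_ltn_trans; rewrite mdegE (bigD1 i) ?leq_addr.
have q0 : q != 0.
  have m0 : mlead p \in msupp p by rewrite mlead_supp.
  apply/eqP => /(congr1 (fun q : {poly K} => q`_(pow (mlead p)))).
  rewrite coef0 coef_sum (bigD1_seq (mlead p)) ?msupp_uniq //= coefZ coefXn eqxx.
  rewrite mulr1 big_seq_cond big1 => [/eqP|m /andP[hm ne]].
    by rewrite addr0 mcoeff_eq0 m0.
  rewrite coefZ coefXn; case: eqP => [E|_]; last by rewrite mulr0.
  case/eqP: ne; apply/mnmP => i; apply/esym.
  by apply: (digits_inj _ _ E) => j; apply: m_lt.
have [t qt] := poly_neq0_nonroot q0; exists (fun i => t ^+ (B ^ i)).
move: qt; rewrite mevalE horner_sum; congr (_ != _); apply: eq_bigr => m _.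
rewrite hornerZ hornerXn -prodrXr; congr (_ * _); apply: eq_bigr => i _.
by rewrite -exprM mulnC.
Qed.

Lemma mpoly_eq0_meval (n : nat) (p : {mpoly K[n]}) :
  (forall v, p.@[v] = 0) -> p = 0.
Proof.
move=> h; apply/eqP/negPn/negP => /mpoly_neq0_nonroot[v].
by rewrite h eqxx.
Qed.

End NonVanishing.

Section Substitution.
Variables (n k : nat) (K : fieldType) (e : nat) (t : n.-tuple {mpoly K[k]}).
Hypothesis ht : forall i, tnth t i \is e.-homog.

Lemma dhomog_comp (d : nat) g : g \is d.-homog -> g \mPo t \is (e * d).-homog.
Proof.
elim/dhomog_lin_ind => [|g1 h1 IHg IHh|c m Em].
- by rewrite comp_mpoly0 rpred0.
- by rewrite comp_mpolyD rpredD.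
rewrite comp_mpolyZ rpredZ // comp_mpolyX -Em mdegE big_distrr /=.
elim/big_rec2: _ => [|i d1 p _ IH]; first exact: dhomog1.
by rewrite dhomogM // dhomogMn.
Qed.

Lemma pihomog_comp (d : nat) g : (0 < e)%N ->
  pihomog mdeg (e * d) (g \mPo t) = pihomog mdeg d g \mPo t.
Proof.
move=> a_gt0; elim/mpoly_lin_ind: g => [|g1 h1 IHg IHh|c m].
- by rewrite !(comp_mpoly0, raddf0).
- by rewrite !(comp_mpolyD, raddfD) /= IHg IHh.
rewrite !(comp_mpolyZ, linearZ) /=; congr (_ *: _).
have hm : 'X_[m] \mPo t \is (e * mdeg m).-homog.
  by apply: dhomog_comp; rewrite dhomogX.
have [E|ne] := eqVneq (mdeg m) d.
  by rewrite -E !pihomog_dE ?dhomogX.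
rewrite (pihomog_ne0 _ hm) ?eqn_pmul2l //.
by rewrite (@pihomog_ne0 _ _ _ (mdeg m)) ?dhomogX ?comp_mpoly0.
Qed.

End Substitution.

(** * Ideals, regular sequences and socles *)

Section Ideals.
Variables (n : nat) (K : fieldType).
Implicit Types (I J : {mpoly K[n]} -> Prop) (f g h x w : {mpoly K[n]}).

Definition adjoin1 I x g : Prop := exists h u, I h /\ g = h + u * x.

Definition zero_ideal g : Prop := g = 0.

Definition homogeneous I : Prop :=
  forall d g, I g -> I (pihomog mdeg d g).

Definition nonzerodivisor_mod I x : Prop := forall h, I (x * h) -> I h.

Definition socle_dim1_in_degree I (d : nat) : Prop :=
  exists w, [/\ w \is d.-homog, in_socle I w, ~ I w
    & forall h, in_socle I h -> exists c : K, I (h - c *: w)].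

Lemma ideal0 I : is_ideal I -> I 0.
Proof. by case. Qed.

Lemma idealD I g h : is_ideal I -> I g -> I h -> I (g + h).
Proof. by case=> _ + _; apply. Qed.

Lemma idealM I u g : is_ideal I -> I g -> I (u * g).
Proof. by case=> _ _; apply. Qed.

Lemma idealMr I u g : is_ideal I -> I g -> I (g * u).
Proof. by rewrite mulrC; apply: idealM. Qed.

Lemma idealN I g : is_ideal I -> I g -> I (- g).
Proof. by move=> II; rewrite -mulN1r; apply: idealM. Qed.

Lemma idealB I g h : is_ideal I -> I g -> I h -> I (g - h).
Proof. by move=> II Ig Ih; apply: idealD => //; apply: idealN. Qed.

Lemma idealZ I c g : is_ideal I -> I g -> I (c *: g).
Proof. by rewrite -mul_mpolyC; apply: idealM. Qed.

Lemma ideal_sum I (T : Type) (r : seq T) (P : pred T) (F : T -> {mpoly K[n]}) :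
  is_ideal I -> (forall i, P i -> I (F i)) -> I (\sum_(i <- r | P i) F i).
Proof.
by move=> II IF; apply: (big_ind I) => //; [apply: ideal0 | move=> *; apply: idealD].
Qed.

Lemma ideal_components I g : is_ideal I ->
  (forall d, I (pihomog mdeg d g)) -> I g.
Proof. by move=> II Ig; rewrite [g]eq_sum_pihomog; apply: ideal_sum. Qed.

Lemma zero_idealP : is_ideal zero_ideal.
Proof.
split=> // [g h|u g]; rewrite /zero_ideal => ->; last by rewrite mulr0.
by rewrite add0r.
Qed.

Lemma zero_ideal_homogeneous : homogeneous zero_ideal.
Proof. by move=> d g ->; rewrite raddf0. Qed.

Lemma adjoin1_ideal I x : is_ideal I -> is_ideal (adjoin1 I x).
Proof.
move=> II; split; first by exists 0, 0; rewrite mul0r addr0; split=> //; apply: ideal0.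
  move=> _ _ [g [u [Ig ->]]] [h [v [Ih ->]]]; exists (g + h), (u + v).
  by split; [apply: idealD | rewrite mulrDl addrACA].
move=> v _ [g [u [Ig ->]]]; exists (v * g), (v * u).
by split; [apply: idealM | rewrite mulrDr mulrA].
Qed.

Lemma adjoin1_sub I x g : I g -> adjoin1 I x g.
Proof. by exists g, 0; rewrite mul0r addr0. Qed.

Lemma adjoin1_gen I x u : is_ideal I -> adjoin1 I x (u * x).
Proof. by exists 0, u; rewrite add0r; split=> //; apply: ideal0. Qed.

Lemma adjoin1_homogeneous I x d : is_ideal I -> homogeneous I ->
  x \is d.-homog -> homogeneous (adjoin1 I x).
Proof.
move=> II hI hx e _ [g [u [Ig ->]]]; rewrite raddfD /=.
have [lt_ed|/subnKC E] := ltnP e d.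
  by rewrite (pihomogM_lt _ hx) // addr0; apply: adjoin1_sub; apply: hI.
exists (pihomog mdeg e g), (pihomog mdeg (e - d) u); split; first exact: hI.
by rewrite -{2}E pihomogM_hom.
Qed.

Lemma adjoin1_mono I J x g : (forall h, I h -> J h) ->
  adjoin1 I x g -> adjoin1 J x g.
Proof. by move=> IJ [h [u [Ih ->]]]; exists h, u; split=> //; apply: IJ. Qed.

Lemma adjoin1C I x y g : adjoin1 (adjoin1 I x) y g -> adjoin1 (adjoin1 I y) x g.
Proof.
move=> [_ [v [[h [u [Ih ->]]] ->]]]; exists (h + v * y), u.
by split; [exists h, v | rewrite addrAC].
Qed.

Lemma socle_dim1_in_degree_ext I J d : (forall g, I g <-> J g) ->
  socle_dim1_in_degree I d -> socle_dim1_in_degree J d.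
Proof.
move=> IJ [w [hw sw Iw uw]]; exists w; split=> //.
- by move=> i; apply/IJ.
- by move/IJ.
move=> h sh; have [i|c Ic] := uw h; first by apply/IJ; apply: sh.
by exists c; apply/IJ.
Qed.

Lemma nonzerodivisor_mod_ext I J x : (forall g, I g <-> J g) ->
  nonzerodivisor_mod I x -> nonzerodivisor_mod J x.
Proof. by move=> IJ hx h /IJ/hx/IJ. Qed.

(* Exactness of the Koszul complex does not depend on the order of the
   sequence. *)
Lemma nonzerodivisor_mod_swap I x y : is_ideal I -> nonzerodivisor_mod I x ->
  nonzerodivisor_mod (adjoin1 I x) y -> nonzerodivisor_mod (adjoin1 I y) x.
Proof.
move=> II hx hy h [i [u [Ii E]]].
have [i' [u' [Ii' Eu]]] : adjoin1 I x u.
  apply: hy; exists (- i), h; split; first exact: idealN.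
  by rewrite [h * x]mulrC E; ring.
exists (h - u' * y), u'; split; last by rewrite subrK.
apply: hx.
suff -> : x * (h - u' * y) = i + i' * y by apply: idealD => //; apply: idealMr.
by rewrite mulrBr E Eu; ring.
Qed.

Lemma in_socle_mul I d g v : is_ideal I -> g \is d.-homog -> (0 < d)%N ->
  in_socle I v -> I (g * v).
Proof.
move=> II hg d_gt0 sv; elim/dhomog_lin_ind: hg => [|g1 g2|c m Em].
- by rewrite mul0r; apply: ideal0.
- by rewrite mulrDl; apply: idealD.
rewrite -scalerAl; apply: idealZ => //.
have [i mi] : exists i, (0 < m i)%N.
  apply/existsP; apply: contraLR d_gt0; rewrite -Em mdegE => /existsPn m0.
  by rewrite big1 // => i _; apply/eqP; rewrite -leqn0 leqNgt m0.
rewrite -(@submK _ U_(i)%MM m) ?mpolyXD -?mulrA; last first.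
  by apply/mnm_lepP => j; rewrite mnm1E; case: eqP => // <-.
by apply: idealM => //; apply: sv.
Qed.

(** Write ['X_j * v = i + h * x] with [i] in [I]. Multiplying by [g] and comparing with ['X_j] times
    the relation [g v = x w] leaves [x * ('X_j * w - h * g)] in [I], and [x] cancels. *)
Lemma adjoin1_socle_lift I x g v : is_ideal I ->
  in_socle (adjoin1 I x) v -> nonzerodivisor_mod I x ->
  forall w, I (g * v - x * w) -> in_socle (adjoin1 I g) w.
Proof.
move=> II sv hx w Iw j; have [i [h [Ii E]]] := sv j.
exists ('X_j * w - h * g), h; split; last by rewrite subrK.
apply: hx.
suff -> : x * ('X_j * w - h * g) = g * i - 'X_j * (g * v - x * w).
  by apply: idealB => //; apply: idealM.
have -> : i = 'X_j * v - h * x by rewrite E addrK.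
ring.
Qed.

(* Both socles are Ext^1(K, S / I) up to a shift: w and v correspond to each
   other when x w = g v modulo I. *)
Lemma socle_transfer I x g (d e : nat) : is_ideal I -> homogeneous I ->
  x \is 1.-homog -> g \is d.-homog -> (0 < d)%N ->
  nonzerodivisor_mod I x -> nonzerodivisor_mod I g ->
  socle_dim1_in_degree (adjoin1 I x) e ->
  socle_dim1_in_degree (adjoin1 I g) (e + d).-1.
Proof.
move=> II hI hx hg d_gt0 nx ng [v [hv sv Iv uv]].
have Ix := adjoin1_ideal x II; have Ig := adjoin1_ideal g II.
have [i [w0 [Ii0 E0]]] := in_socle_mul Ix hg d_gt0 sv.
(* The quotient [w0] need not be homogeneous; since [x] has degree 1, its component of degree
   [e + d - 1] satisfies the same relation. *)
pose w := pihomog mdeg (e + d).-1 w0.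
have ed : (e + d = 1 + (e + d).-1)%N by case: (d) d_gt0 => // k _; rewrite addnS.
have Iw : I (g * v - x * w).
  have hgv : g * v \is (e + d).-homog by rewrite addnC dhomogM.
  rewrite -(pihomog_dE hgv) E0 raddfD /= {2}ed (pihomogM_hom _ _ hx) mulrC addrK.
  exact: hI.
exists w; split; first exact: pihomogP.
- exact: (adjoin1_socle_lift II sv nx).
- move=> [j [u [Ij Ew]]]; apply: Iv; exists (v - u * x), u; split; last by rewrite subrK.
  apply: ng; rewrite mulrBr.
  have -> : g * v - g * (u * x) = (g * v - x * w) + x * j by rewrite Ew; ring.
  by apply: idealD => //; apply: idealM.
(* The construction runs backwards with [x] and [g] exchanged: it sends [w'] to a socle element [v']
   modulo [x], which is a multiple of [v]. *)
move=> w' sw'.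
have [j [v' [Ij E']]] := in_socle_mul Ig hx isT sw'.
have sv' : in_socle (adjoin1 I x) v'.
  apply: (adjoin1_socle_lift II sw' ng).
  by rewrite E' [v' * g]mulrC addrK.
have [c [k [u [Ik Ev]]]] := uv _ sv'.
exists c; exists (w' - c *: w - u * g), u; split; last by rewrite subrK.
apply: nx.
have -> : x * (w' - c *: w - u * g) = j + g * k + c *: (g * v - x * w).
  rewrite !mulrBr E' -!scalerAr.
  have -> : v' = c *: v + k + u * x by rewrite -addrA -Ev addrC subrK.
  rewrite -!mul_mpolyC; ring.
apply: idealD; [done | apply: idealD => //; exact: idealM | exact: idealZ].
Qed.

(** Induction downwards from degree [d], where the test form may be taken to be 1: below [d], all
    ['X_i * h] are in [I] by induction, so [h] is a socle form of degree other than [d], hence zero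
    modulo [I]. *)
Lemma gorenstein_pairing I (d k : nat) g : is_ideal I -> homogeneous I ->
  socle_dim1_in_degree I d ->
  (exists e, forall h k, (e <= k)%N -> h \is k.-homog -> I h) ->
  g \is k.-homog -> (k <= d)%N ->
  (forall h, h \is (d - k).-homog -> I (h * g)) -> I g.
Proof.
move=> II hI [w [hw sw Iw uw]] [e he] hg le_kd hd.
have socle_deg l h : h \is l.-homog -> in_socle I h -> l != d -> I h.
  move=> hh sh ne; have [c /(hI l)] := uw h sh.
  by rewrite raddfB /= linearZ /= pihomog_dE // (pihomog_ne0 _ hw) 1?eq_sym // scaler0 subr0.
have climb j h : h \is (k + j).-homog -> (j <= d - k)%N ->
      (forall p, p \is (d - k - j).-homog -> I (p * h)) -> I h.
  have [r] := ubnP (e - (k + j)); elim: r j h => // r IH j h lt_r hh le_j hp.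
  have [le_e|lt_e] := leqP e (k + j); first exact: he hh.
  have [j_eq|ne_j] := eqVneq j (d - k)%N.
    by rewrite -[h]mul1r; apply: hp; rewrite j_eq subnn dhomog1.
  have lt_j : (j < d - k)%N by rewrite ltn_neqAle ne_j.
  apply: (socle_deg _ _ hh); last first.
    by apply: contra ne_j => /eqP <-; rewrite addKn.
  move=> i; have hi : 'X_i * h \is (k + j.+1).-homog.
    by rewrite addnS -add1n dhomogM // dhomogXU.
  apply: (IH j.+1) => //; first by rewrite addnS; lia.
  move=> p hp'; rewrite mulrA; apply: hp.
  have -> : (d - k - j = d - k - j.+1 + 1)%N by lia.
  by rewrite dhomogM // dhomogXU.
by apply: (climb 0%N); rewrite ?addn0 ?subn0.
Qed.

End Ideals.

Notation i0 := (@Ordinal 3 0 isT).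
Notation i1 := (@Ordinal 3 1 isT).
Notation i2 := (@Ordinal 3 2 isT).

Lemma ord3P (i : 'I_3) : [\/ i = i0, i = i1 | i = i2].
Proof.
by case: i => [[|[|[|//]]] hi];
  [apply: Or31 | apply: Or32 | apply: Or33]; apply: val_inj.
Qed.

(** * Quotients that are retracts of the polynomial ring *)

Section Substitutions.
Variables (n : nat) (K : fieldType).
Implicit Types (I : {mpoly K[n]} -> Prop) (t : n.-tuple {mpoly K[n]}).

Lemma ideal_comp_congr I t g : is_ideal I ->
  (forall i, I (tnth t i - 'X_i)) -> I (g \mPo t - g).
Proof.
move=> II It; elim/mpoly_lin_ind: g => [|g h Ig Ih|c m].
- by rewrite comp_mpoly0 subr0; apply: ideal0.
- by rewrite comp_mpolyD opprD addrACA; apply: idealD.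
rewrite comp_mpolyZ -scalerBr; apply: idealZ => //.
rewrite comp_mpolyX [X in _ - X]mpolyXE_id.
elim/big_rec2: _ => [|i x y _ Ixy]; first by rewrite subrr; apply: ideal0.
set a := tnth t i ^+ m i; set b := 'X_i ^+ m i.
have -> : a * y - b * x = a * (y - x) + (a - b) * x by ring.
apply: idealD => //; first exact: idealM.
by apply: idealMr => //; rewrite subrXX; apply: idealMr.
Qed.

(** The substitution [t] is the identity modulo [I] and kills [I], so it embeds the quotient by [I]
    in a polynomial ring, which is a domain. *)
Lemma nonzerodivisor_mod_comp I t p : is_ideal I ->
  (forall i, I (tnth t i - 'X_i)) -> (forall g, I g -> g \mPo t = 0) ->
  p \mPo t != 0 -> nonzerodivisor_mod I p.
Proof.
move=> II It I0 p0 h /I0; rewrite rmorphM /= => /eqP.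
rewrite mulf_eq0 (negPf p0) /= => /eqP E.
by rewrite -[h]opprK -[- h]add0r -E; apply: idealN => //; apply: ideal_comp_congr.
Qed.

End Substitutions.

(** * The socle of a complete intersection of three plane curves *)

Section CompleteIntersection.
Variable K : fieldType.
Local Notation S := {mpoly K[3]}.
Local Notation I0 := (@zero_ideal 3 K).
Local Notation X0 := ('X_i0 : S).
Local Notation X1 := ('X_i1 : S).
Local Notation X2 := ('X_i2 : S).

Definition point3 (a b c : K) : 'I_3 -> K := fun i => nth 0 [:: a; b; c] i.

Let t0 : 3.-tuple S := [tuple 0; X1; X2].
Let t01 : 3.-tuple S := [tuple 0; 0; X2].

Let I0P := @zero_idealP 3 K.
Let J0 := adjoin1 I0 X0.
Let J0P : is_ideal J0 := adjoin1_ideal X0 I0P.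
Let J01 := adjoin1 J0 X1.
Let J01P : is_ideal J01 := adjoin1_ideal X1 J0P.

Lemma adjoin1_X0_t0 i : J0 (tnth t0 i - 'X_i).
Proof.
case: (ord3P i) => ->; rewrite (tnth_nth 0) /= ?subrr; try exact: ideal0.
by rewrite sub0r -mulN1r; apply: adjoin1_gen.
Qed.

Lemma adjoin1_X0_comp_t0 g : J0 g -> g \mPo t0 = 0.
Proof.
move=> [_ [u [-> ->]]].
by rewrite add0r rmorphM /= comp_mpolyXU /= mulr0.
Qed.

Lemma adjoin1_X01_t01 i : J01 (tnth t01 i - 'X_i).
Proof.
case: (ord3P i) => ->; rewrite (tnth_nth 0) /= ?subrr; try exact: ideal0.
  by rewrite sub0r -mulN1r; apply: adjoin1_sub; apply: adjoin1_gen.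
by rewrite sub0r -mulN1r; apply: adjoin1_gen.
Qed.

Lemma adjoin1_X01_comp_t01 g : J01 g -> g \mPo t01 = 0.
Proof.
move=> [_ [v [[_ [u [-> ->]]] ->]]].
by rewrite add0r rmorphD !rmorphM /= !comp_mpolyXU /= !mulr0 addr0.
Qed.

Lemma mpolyXU_neq0 (i : 'I_3) : ('X_i : S) != 0.
Proof. by rewrite -msupp_eq0 msuppX. Qed.

(** Start of the exchange: the quotient is the residue field, which is its own socle, generated by
    1. *)
Lemma socle_maximal_ideal : socle_dim1_in_degree (adjoin1 J01 X2) 0.
Proof.
have II := adjoin1_ideal X2 J01P.
have s1 : in_socle (adjoin1 J01 X2) 1.
  move=> i; rewrite mulr1 -['X_i]mul1r; case: (ord3P i) => ->.
  - by do 2!apply: adjoin1_sub; apply: adjoin1_gen.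
  - by apply: adjoin1_sub; apply: adjoin1_gen.
  - exact: adjoin1_gen.
exists 1; split=> //; first exact: dhomog1.
  move=> [_ [w [[_ [v [[_ [u [-> ->]]] ->]]] E]]].
  have := congr1 (meval (fun=> 0)) E.
  by rewrite meval1 !(mevalD, mevalM, mevalXU) meval0 !mulr0 !addr0 => /eqP; rewrite oner_eq0.
move=> h _; elim/mpoly_lin_ind: h => [|g h [c Ig] [d Ih]|c m].
- by exists 0; rewrite scale0r subr0; apply: ideal0.
- by exists (c + d); rewrite scalerDl opprD addrACA; apply: idealD.
have [->|m0] := eqVneq m 0%MM.
  by exists c; rewrite mpolyX0 subrr; apply: ideal0.
exists 0; rewrite scale0r subr0; apply: idealZ => //; rewrite -[_ m]mulr1.
by apply: (in_socle_mul II (d := mdeg m)) => //; rewrite ?dhomogX // lt0n mdeg_eq0.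
Qed.

Section Chain.
Variables (m : nat) (q1 q2 : S).
Hypotheses (m_gt0 : (0 < m)%N) (hq1 : q1 \is m.-homog) (hq2 : q2 \is m.-homog).
Hypothesis q1_vertex : q1.@[point3 0 0 1] != 0.
Variable M : nat.
Hypothesis X1M : adjoin1 (adjoin1 J0 q1) q2 (X1 ^+ M).

(** Both retractions used here fix the vertex [(0, 0, 1)], where [q1] does not vanish. *)
Let q1_comp (t : 3.-tuple S) : (forall i, (tnth t i).@[point3 0 0 1] = point3 0 0 1 i) ->
  q1 \mPo t != 0.
Proof.
move=> ht; apply: contra q1_vertex => /eqP /(congr1 (meval (point3 0 0 1))).
by rewrite comp_mpoly_meval meval0 => E; rewrite -[eqbRHS]E; apply/eqP/meval_eq => i; rewrite ht.
Qed.

Let nzd_X0_X1 : nonzerodivisor_mod J0 X1.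
Proof.
apply: nonzerodivisor_mod_comp adjoin1_X0_t0 adjoin1_X0_comp_t0 _ => //.
by rewrite comp_mpolyXU /= mpolyXU_neq0.
Qed.

Let nzd_X0_q1 : nonzerodivisor_mod J0 q1.
Proof.
apply: nonzerodivisor_mod_comp adjoin1_X0_t0 adjoin1_X0_comp_t0 _ => //.
by apply: q1_comp => i; case: (ord3P i) => ->; rewrite (tnth_nth 0) /= ?meval0 ?mevalXU.
Qed.

Let nzd_X01_X2 : nonzerodivisor_mod J01 X2.
Proof.
apply: nonzerodivisor_mod_comp adjoin1_X01_t01 adjoin1_X01_comp_t01 _ => //.
by rewrite comp_mpolyXU /= mpolyXU_neq0.
Qed.

Let nzd_X01_q1 : nonzerodivisor_mod J01 q1.
Proof.
apply: nonzerodivisor_mod_comp adjoin1_X01_t01 adjoin1_X01_comp_t01 _ => //.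
by apply: q1_comp => i; case: (ord3P i) => ->; rewrite (tnth_nth 0) /= ?meval0 ?mevalXU.
Qed.

Let nzd_X0q1_X1 : nonzerodivisor_mod (adjoin1 J0 q1) X1.
Proof. exact: nonzerodivisor_mod_swap. Qed.

(** Modulo [(X0, q1)] the power [X1 ^ M] is a multiple of [q2], and [X1] is a nonzerodivisor there,
    so whatever [q2] annihilates is zero. *)
Let nzd_X0q1_q2 : nonzerodivisor_mod (adjoin1 J0 q1) q2.
Proof.
have [i [u [Ii E]]] := X1M; move=> h Ih.
have Jq := adjoin1_ideal q1 J0P.
have {E} : adjoin1 J0 q1 (X1 ^+ M * h).
  rewrite E mulrDl -mulrA; apply: idealD => //; first exact: idealMr.
  exact: idealM.
elim: M => [|k IH]; first by rewrite mul1r.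
by rewrite exprS -mulrA => /nzd_X0q1_X1.
Qed.

Let nzd_q1_X0 : nonzerodivisor_mod (adjoin1 I0 q1) X0.
Proof.
apply: nonzerodivisor_mod_swap => // h; rewrite /zero_ideal => /eqP.
by rewrite mulf_eq0 (negPf (mpolyXU_neq0 _)) => /eqP.
Qed.

Let Jq12 := adjoin1 (adjoin1 I0 q1) q2.

Lemma nonzerodivisor_X0 : nonzerodivisor_mod Jq12 X0.
Proof.
apply: nonzerodivisor_mod_swap => //; first exact: adjoin1_ideal.
by apply: nonzerodivisor_mod_ext nzd_X0q1_q2 => g; split; apply: adjoin1C.
Qed.

(** Three exchanges, from [(X0, X1, X2)] to [(X0, X1, q1)] to [(X0, q1, q2)] to [(q1, q2, f)], give
    the socle degrees [0], [m - 1], [2 m - 2] and [2 m + d - 3]. *)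
Lemma complete_intersection_socle (d : nat) f : (0 < d)%N -> f \is d.-homog ->
  nonzerodivisor_mod Jq12 f ->
  socle_dim1_in_degree (adjoin1 Jq12 f) (m + m + d - 3).
Proof.
move=> d_gt0 hf nf.
have hJ0 : homogeneous J0.
  by apply: adjoin1_homogeneous (dhomogXU _ _) => //; apply: zero_ideal_homogeneous.
have hJ01 : homogeneous J01 by apply: adjoin1_homogeneous (dhomogXU _ _).
have hJq : homogeneous (adjoin1 J0 q1) by apply: adjoin1_homogeneous hq1.
have hI1 : homogeneous (adjoin1 I0 q1).
  by apply: adjoin1_homogeneous hq1 => //; apply: zero_ideal_homogeneous.
have hI12 : homogeneous Jq12.
  by apply: adjoin1_homogeneous hq2 => //; apply: adjoin1_ideal.
have s1 := socle_transfer J01P hJ01 (dhomogXU _ _) hq1 m_gt0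
  nzd_X01_X2 nzd_X01_q1 socle_maximal_ideal.
have s2 := socle_transfer (adjoin1_ideal q1 J0P) hJq (dhomogXU _ _) hq2 m_gt0
  nzd_X0q1_X1 nzd_X0q1_q2
  (socle_dim1_in_degree_ext (fun g => conj (@adjoin1C _ _ _ _ _ g) (@adjoin1C _ _ _ _ _ g)) s1).
have Jq12P : is_ideal Jq12 by do 2!apply: adjoin1_ideal.
have := socle_transfer Jq12P hI12 (dhomogXU _ _) hf d_gt0 nonzerodivisor_X0 nf.
have -> : (m + m + d - 3 = (((0 + m).-1 + m).-1 + d).-1)%N by lia.
apply; apply: socle_dim1_in_degree_ext s2 => g; split.
  move/(adjoin1_mono (@adjoin1C _ _ _ _ _)).
  exact: adjoin1C.
move/adjoin1C.
exact: (adjoin1_mono (@adjoin1C _ _ _ _ _)).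
Qed.

End Chain.

End CompleteIntersection.

(** * Sylvester matrices of prescribed size *)

Section Sylvester.

(* The formal degrees d1 of p and d2 of q are prescribed, so that the
   determinant commutes with every specialization of the coefficients. *)
Definition sylvester_row (A : comNzRingType) (d1 d2 : nat) (p q : {poly A})
    (i : 'I_(d2 + d1)) : {poly A} :=
  match split i with inl k => p * 'X^k | inr k => q * 'X^k end.

Definition sylvester (A : comNzRingType) (d1 d2 : nat) (p q : {poly A}) :
    'M[A]_(d2 + d1) :=
  \matrix_(i, j) (sylvester_row p q i)`_j.

Lemma map_sylvester (A B : comNzRingType) (phi : {rmorphism A -> B})
    (d1 d2 : nat) (p q : {poly A}) :
  map_mx phi (sylvester d1 d2 p q) =
  sylvester d1 d2 (map_poly phi p) (map_poly phi q).
Proof.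
apply/matrixP => i j; rewrite !mxE -coef_map /sylvester_row.
by case: split => k; rewrite rmorphM /= map_polyXn.
Qed.

Lemma map_det_sylvester (A B : comNzRingType) (phi : {rmorphism A -> B})
    (d1 d2 : nat) (p q : {poly A}) :
  phi (\det (sylvester d1 d2 p q)) =
  \det (sylvester d1 d2 (map_poly phi p) (map_poly phi q)).
Proof. by rewrite -map_sylvester det_map_mx. Qed.

Section Ring.
Variables (A : comNzRingType) (d1 d2 : nat) (p q : {poly A}).
Hypotheses (hp : (size p <= d1.+1)%N) (hq : (size q <= d2.+1)%N).

Lemma size_sylvester_row i : (size (sylvester_row (d1 := d1) (d2 := d2) p q i) <= d2 + d1)%N.
Proof.
rewrite /sylvester_row; case: split => k; apply: leq_trans (size_polyMleq _ _) _;
  rewrite size_polyXn; have := ltn_ord k; lia.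
Qed.

Lemma sylvester_row_comb (c : 'rV[A]_(d2 + d1)) :
  \sum_i c 0 i *: sylvester_row p q i =
  rVpoly (lsubmx c) * p + rVpoly (rsubmx c) * q.
Proof.
have rVE d (v : 'rV[A]_d) : rVpoly v = \sum_i v 0 i *: 'X^i.
  rewrite {1}[v]row_sum_delta linear_sum; apply: eq_bigr => i _.
  by rewrite linearZ /= rVpoly_delta.
rewrite big_split_ord !rVE !mulr_suml /=; congr (_ + _); apply: eq_bigr => k _;
  rewrite /sylvester_row ?(unsplitK (inl _ k)) ?(unsplitK (inr _ k)) mxE;
  by rewrite -scalerAl mulrC.
Qed.

Lemma sylvester_mulr (c : 'rV[A]_(d2 + d1)) :
  rVpoly (c *m sylvester d1 d2 p q) =
  rVpoly (lsubmx c) * p + rVpoly (rsubmx c) * q.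
Proof.
rewrite -sylvester_row_comb; apply/polyP => j; rewrite coef_rVpoly coef_sum.
case: insubP => [k lt_j <-|]; rewrite ?mxE.
  by apply: eq_bigr => i _; rewrite coefZ mxE.
rewrite -leqNgt => le_j; rewrite big1 // => i _; rewrite coefZ nth_default ?mulr0 //.
exact: leq_trans (size_sylvester_row _) le_j.
Qed.

(** The two blocks of this row are cofactors [u], [v] with [u p + v q = Res g]. As polynomial
    expressions in the coefficients they commute with specialization, so their divisibility by
    [X - x] can be tested at [x]. *)
Definition sylvester_cramer (g : {poly A}) : 'rV[A]_(d2 + d1) :=
  poly_rV g *m \adj (sylvester d1 d2 p q).

Lemma sylvester_cramerE (g : {poly A}) : (size g <= d2 + d1)%N ->
  \det (sylvester d1 d2 p q) *: g =
  rVpoly (lsubmx (sylvester_cramer g)) * p + rVpoly (rsubmx (sylvester_cramer g)) * q.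
Proof.
move=> hg; rewrite -sylvester_mulr -mulmxA mul_adj_mx mul_mx_scalar linearZ /=.
by rewrite poly_rV_K.
Qed.

End Ring.

Lemma map_sylvester_cramer (A B : comNzRingType) (phi : {rmorphism A -> B})
    (d1 d2 : nat) (p q g : {poly A}) :
  map_mx phi (sylvester_cramer d1 d2 p q g) =
  sylvester_cramer d1 d2 (map_poly phi p) (map_poly phi q) (map_poly phi g).
Proof.
rewrite /sylvester_cramer map_mxM map_mx_adj map_sylvester; congr (_ *m _).
by apply/rowP => j; rewrite !mxE coef_map.
Qed.

Section Field.
Variables (F : fieldType) (d1 d2 : nat) (p q : {poly F}).
Hypotheses (hp : (size p <= d1.+1)%N) (hq : (size q <= d2.+1)%N).

Let power_row (x : F) : 'rV[F]_(d2 + d1) := \row_j x ^+ j.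

Let power_row_neq0 x : (0 < d2 + d1)%N -> power_row x != 0.
Proof.
move=> d_gt0; apply/eqP => /rowP/(_ (Ordinal d_gt0)).
by rewrite !mxE expr0 => /eqP; rewrite oner_eq0.
Qed.

Let mul_power_row (M : 'M[F]_(d2 + d1)) x :
  (forall i, \sum_j M i j * x ^+ j = 0) -> (0 < d2 + d1)%N -> \det M = 0.
Proof.
move=> hM d_gt0; apply/eqP; rewrite -det_tr; apply/det0P.
exists (power_row x); first exact: power_row_neq0.
apply/rowP => i; rewrite !mxE -[RHS](hM i); apply: eq_bigr => j _.
by rewrite !mxE mulrC.
Qed.

Let sylvester_eval x i :
  \sum_j sylvester d1 d2 p q i j * x ^+ j = (sylvester_row p q i).[x].
Proof.
rewrite (horner_coef_wide _ (size_sylvester_row hp hq i)).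
by apply: eq_bigr => j _; rewrite mxE.
Qed.

Let sylvester_row_root x i : p.[x] = 0 -> q.[x] = 0 ->
  (sylvester_row (d1 := d1) (d2 := d2) p q i).[x] = 0.
Proof.
by move=> px qx; rewrite /sylvester_row; case: split => k; rewrite hornerM ?px ?qx mul0r.
Qed.

Lemma sylvester_common_root x : (0 < d2 + d1)%N -> p.[x] = 0 -> q.[x] = 0 ->
  \det (sylvester d1 d2 p q) = 0.
Proof.
move=> d_gt0 px qx; apply: (@mul_power_row _ x) d_gt0 => i.
by rewrite sylvester_eval sylvester_row_root.
Qed.

(* Each entry is the determinant of the Sylvester matrix with one row replaced
   by g, which kills the vector of powers of x. *)
Lemma sylvester_cramer_root (g : {poly F}) x (k : 'I_(d2 + d1)) : (size g <= d2 + d1)%N ->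
  p.[x] = 0 -> q.[x] = 0 -> g.[x] = 0 ->
  sylvester_cramer d1 d2 p q g 0 k = 0.
Proof.
move=> hg px qx gx; pose M := sylvester d1 d2 p q.
pose N : 'M[F]_(d2 + d1) := \matrix_(i, j) if i == k then g`_j else M i j.
have d_gt0 : (0 < d2 + d1)%N by apply: leq_ltn_trans (ltn_ord k).
have N0 : \det N = 0.
  apply: (mul_power_row (x := x)) => // i; have [->|ne] := eqVneq i k.
    rewrite -[RHS]gx (horner_coef_wide _ hg); apply: eq_bigr => j _.
    by rewrite mxE eqxx.
  rewrite -[RHS](sylvester_row_root i px qx) -sylvester_eval; apply: eq_bigr => j _.
  by rewrite mxE (negPf ne).
rewrite mxE -[RHS]N0 (expand_det_row N k); apply: eq_bigr => j _.
rewrite !mxE eqxx; congr (_ * _); rewrite /cofactor; congr (_ * \det _).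
by apply/matrixP => i l; rewrite !mxE eq_sym (negPf (neq_lift _ _)).
Qed.

(** A left kernel vector is a relation [u p + v q = 0] with [size v <= d1]. Coprimality would make
    [p] divide [v], so [v = 0] and then [u = 0]. The degree of [p] is exact, while that of [q] may
    drop. *)
Lemma sylvester_not_coprime : size p = d1.+1 -> \det (sylvester d1 d2 p q) = 0 ->
  ~~ coprimep p q.
Proof.
move=> sp /eqP/det0P[c c0 cM]; apply: contra c0 => cop.
have p0 : p != 0 by rewrite -size_poly_gt0 sp.
have := sylvester_mulr hp hq c; rewrite cM linear0 => /esym E.
have /eqP r0 : rVpoly (rsubmx c) == 0.
  have : (size (rVpoly (rsubmx c)) <= d1)%N by apply: size_poly.
  apply: contraTT => r0; rewrite -ltnNge.
  rewrite -sp dvdp_leq // -(Gauss_dvdpl _ cop); apply/dvdpP.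
  by exists (- rVpoly (lsubmx c)); rewrite mulNr; apply/eqP; rewrite -addr_eq0 addrC E.
move/eqP: E; rewrite r0 mul0r addr0 mulf_eq0 (negPf p0) orbF => /eqP l0.
by rewrite -[c]hsubmxK -[lsubmx c]rVpolyK -[rsubmx c]rVpolyK l0 r0 linear0 linear0 row_mx0.
Qed.

Lemma sylvester_bezout : (0 < d2 + d1)%N -> \det (sylvester d1 d2 p q) != 0 ->
  exists u v, u * p + v * q = 1.
Proof.
move=> d_gt0 D0; set D := \det _ in D0.
have s1 : (size (1%R : {poly F}) <= d2 + d1)%N by rewrite size_poly1.
have := sylvester_cramerE hp hq s1; set u := rVpoly _; set v := rVpoly _ => E.
exists (D^-1 *: u), (D^-1 *: v); rewrite -!scalerAl -scalerDr -E scalerA mulVf //.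
by rewrite scale1r.
Qed.

End Field.

(* In each product of the Leibniz expansion the bounds
   deg <= m + (row shift) - (column) add up to m ^ 2. *)
Lemma size_det_sylvester (K : fieldType) (m : nat) (p q : {poly {poly K}}) :
  (forall j, p`_j != 0 -> (size (p`_j)%R + j <= m.+1)%N) ->
  (forall j, q`_j != 0 -> (size (q`_j)%R + j <= m.+1)%N) ->
  (size (\det (sylvester m m p q)) <= (m ^ 2).+1)%N.
Proof.
move=> hp hq; apply: leq_trans (size_sum _ _ _) _; apply/bigmax_leqP => s _.
rewrite mulr_sign; set P := \prod_i _.
suff : (size P <= (m ^ 2).+1)%N by case: odd_perm; rewrite ?size_polyN.
have [[i Mi]|all_neq0] : (exists i, sylvester m m p q i (s i) = 0) \/
    (forall i, sylvester m m p q i (s i) != 0).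
  have [/existsP[i /eqP]|/existsPn] := boolP [exists i, sylvester m m p q i (s i) == 0].
    by left; exists i.
  by right.
- by rewrite /P (bigD1 i) //= Mi mul0r size_poly0.
pose shift (i : 'I_(m + m)) : nat := match split i with inl k => k | inr k => k end.
have entry i : (size (sylvester m m p q i (s i)) + s i <= m.+1 + shift i)%N.
  have := all_neq0 i; rewrite mxE /sylvester_row /shift.
  case: split => k; rewrite coefMXn; case: ltnP => [_|le_k]; rewrite ?eqxx // => /[dup].
    by move=> _ /hp; rewrite -(leq_add2r k) -addnA subnK.
  by move=> _ /hq; rewrite -(leq_add2r k) -addnA subnK.
have := leq_sum (index_enum 'I_(m + m)) (P := predT) (fun i _ => entry i).
rewrite !big_split /= (reindex_inj (@perm_inj _ s^-1)) /=.
rewrite [X in (_ + X <= _)%N](reindex_inj (@perm_inj _ s^-1)) /=.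
rewrite [X in (_ + X <= _)%N](eq_bigr (fun i => nat_of_ord i)); last by move=> i _; rewrite permKV.
rewrite [X in (X + _ <= _)%N](_ : _ = (\sum_i size (sylvester m m p q i (s i)))%N); last first.
  by rewrite [RHS](reindex_inj (@perm_inj _ s^-1)).
rewrite sum_nat_const card_ord.
rewrite [X in (_ + X <= _)%N]big_split_ord [X in (_ <= _ + X)%N]big_split_ord /=.
have -> : (\sum_(i < m) shift (lshift m i) = \sum_(i < m) i)%N.
  by apply: eq_bigr => i _; rewrite /shift (unsplitK (inl _ i)).
have -> : (\sum_(i < m) shift (rshift m i) = \sum_(i < m) i)%N.
  by apply: eq_bigr => i _; rewrite /shift (unsplitK (inr _ i)).
rewrite big_split /= sum_nat_const card_ord => le_sum.
(* The sizes add up to at most [m ^ 2 + 2 m], because the column indices sum to [m ^ 2] more than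
   the shifts; passing to the product of [2 m] factors then removes [2 m] and adds 1. *)
apply: leq_trans (size_prod_leq _ _) _; rewrite /= card_ord.
by move: le_sum; set x := (\sum_i size _)%N; set y := (\sum_(i < m) _)%N; nia.
Qed.

End Sylvester.

(** * Affine chart and line at infinity *)

Lemma prod_ord3 (A : pzSemiRingType) (F : 'I_3 -> A) :
  \prod_i F i = F i0 * F i1 * F i2.
Proof.
rewrite !big_ord_recl big_ord0 mulr1 mulrA.
by congr (F _ * F _ * F _); apply: val_inj.
Qed.

Lemma mdeg3 (m : 'X_{1..3}) : mdeg m = (m i0 + m i1 + m i2)%N.
Proof.
rewrite mdegE !big_ord_recl big_ord0 addn0 addnA.
by congr (m _ + m _ + m _)%N; apply: val_inj.
Qed.

Section Dehomogenization.

Fact affine_key : unit. Proof. exact: tt. Qed.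

(* g (1, x, y), a polynomial in y over K[x]; locked to keep unification from
   unfolding it *)
Definition affine (A : comNzRingType) : {mpoly A[3]} -> {poly {poly A}} :=
  locked_with affine_key
    (mmap (polyC \o polyC) (fun i => nth 0 [:: 1; 'X%:P; 'X] i)).

(* g (0, 1, y) *)
Definition at_infinity (A : comNzRingType) : {mpoly A[3]} -> {poly A} :=
  locked_with affine_key (mmap polyC (fun i => nth 0 [:: 0; 1; 'X] i)).

Fact affine_is_zmod_morphism A : zmod_morphism (@affine A).
Proof. by rewrite /affine unlock; exact: rmorphB. Qed.

Fact affine_is_monoid_morphism A : monoid_morphism (@affine A).
Proof. by rewrite /affine unlock; split; [exact: rmorph1 | exact: rmorphM]. Qed.

Fact at_infinity_is_zmod_morphism A : zmod_morphism (@at_infinity A).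
Proof. by rewrite /at_infinity unlock; exact: rmorphB. Qed.

Fact at_infinity_is_monoid_morphism A : monoid_morphism (@at_infinity A).
Proof. by rewrite /at_infinity unlock; split; [exact: rmorph1 | exact: rmorphM]. Qed.

HB.instance Definition _ (A : comNzRingType) :=
  GRing.isZmodMorphism.Build {mpoly A[3]} {poly {poly A}} (@affine A)
    (@affine_is_zmod_morphism A).

HB.instance Definition _ (A : comNzRingType) :=
  GRing.isMonoidMorphism.Build {mpoly A[3]} {poly {poly A}} (@affine A)
    (@affine_is_monoid_morphism A).

HB.instance Definition _ (A : comNzRingType) :=
  GRing.isZmodMorphism.Build {mpoly A[3]} {poly A} (@at_infinity A)
    (@at_infinity_is_zmod_morphism A).

HB.instance Definition _ (A : comNzRingType) :=
  GRing.isMonoidMorphism.Build {mpoly A[3]} {poly A} (@at_infinity A)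
    (@at_infinity_is_monoid_morphism A).

Section Ring.
Variable A : comNzRingType.

Lemma affineD : {morph @affine A : g h / g + h}. Proof. exact: rmorphD. Qed.

Lemma affineB : {morph @affine A : g h / g - h}. Proof. exact: rmorphB. Qed.

Lemma affineM : {morph @affine A : g h / g * h}. Proof. exact: rmorphM. Qed.

Lemma affineXn k : {morph @affine A : g / g ^+ k}. Proof. exact: rmorphXn. Qed.

Lemma affineX (c : A) m : affine (c *: 'X_[m]) = (c *: 'X^(m i1))%:P * 'X^(m i2).
Proof.
rewrite /affine unlock mmapZ mmapX /mmap1 prod_ord3 /= expr1n mul1r.
by rewrite -[c *: _]mul_polyC polyCM polyC_exp mulrA.
Qed.

Lemma at_infinityX (c : A) m :
  at_infinity (c *: 'X_[m]) = (c * 0 ^+ m i0) *: 'X^(m i2).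
Proof.
rewrite /at_infinity unlock mmapZ mmapX /mmap1 prod_ord3 /= expr1n mulr1.
by rewrite -mul_polyC polyCM mulrA rmorphXn /= polyC0.
Qed.

End Ring.

Lemma map_mpolyZX (n : nat) (A B : nzRingType) (phi : {rmorphism A -> B}) (c : A) m :
  map_mpoly phi (c *: 'X_[m]) = phi c *: 'X_[m] :> {mpoly B[n]}.
Proof. by rewrite -!mul_mpolyC rmorphM /= map_mpolyC map_mpolyX. Qed.

Lemma map_affine (A B : comNzRingType) (phi : {rmorphism A -> B}) (g : {mpoly A[3]}) :
  map_poly (map_poly phi) (affine g) = affine (map_mpoly phi g).
Proof.
elim/mpoly_lin_ind: g => [|g h IHg IHh|c m]; first by rewrite !raddf0.
  by rewrite !raddfD /= IHg IHh.
rewrite affineX map_mpolyZX affineX rmorphM /=.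
by rewrite map_polyC map_polyXn /= linearZ /= map_polyXn.
Qed.

Lemma map_at_infinity (A B : comNzRingType) (phi : {rmorphism A -> B}) (g : {mpoly A[3]}) :
  map_poly phi (at_infinity g) = at_infinity (map_mpoly phi g).
Proof.
elim/mpoly_lin_ind: g => [|g h IHg IHh|c m]; first by rewrite !raddf0.
  by rewrite !raddfD /= IHg IHh.
rewrite at_infinityX map_mpolyZX at_infinityX.
by rewrite linearZ /= map_polyXn rmorphM /= rmorphXn rmorph0.
Qed.

Section Field.
Variable K : fieldType.
Local Notation S := {mpoly K[3]}.
Implicit Type g : S.

Lemma affine_eval g a b : (affine g).[b%:P].[a] = g.@[point3 1 a b].
Proof.
elim/mpoly_lin_ind: g => [|g h IHg IHh|c m]; first by rewrite raddf0 !horner0 meval0.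
  by rewrite raddfD !hornerD mevalD IHg IHh.
rewrite affineX mevalZ mevalX prod_ord3 /= expr1n mul1r.
by rewrite !(hornerM, hornerC, hornerZ, hornerXn, horner_exp) -mulrA.
Qed.

Lemma at_infinity_eval g b : (at_infinity g).[b] = g.@[point3 0 1 b].
Proof.
elim/mpoly_lin_ind: g => [|g h IHg IHh|c m]; first by rewrite raddf0 horner0 meval0.
  by rewrite raddfD hornerD mevalD IHg IHh.
rewrite at_infinityX mevalZ mevalX prod_ord3 /= expr1n mulr1.
by rewrite !(hornerZ, hornerXn) mulrA.
Qed.

Lemma size_coef_affine (d : nat) g j : g \is d.-homog ->
  (size ((affine g)`_j)%R <= d.+1 - j)%N.
Proof.
elim/dhomog_lin_ind => [|g1 g2 IH1 IH2|c m Em]; first by rewrite raddf0 coef0 size_poly0.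
  rewrite raddfD coefD; apply: leq_trans (size_polyD _ _) _.
  by rewrite geq_max IH1 IH2.
rewrite affineX coefCM coefXn; case: eqP => [->|_]; last by rewrite mulr0 size_poly0.
rewrite mulr1; apply: leq_trans (size_scale_leq _ _) _.
by rewrite size_polyXn -Em mdeg3; lia.
Qed.

Lemma size_coef_affine_add (d : nat) g j : g \is d.-homog ->
  (affine g)`_j != 0 -> (size ((affine g)`_j)%R + j <= d.+1)%N.
Proof.
move=> /(size_coef_affine j); rewrite -size_poly_gt0.
by set s := size _ => le_s s_gt0; lia.
Qed.

Lemma size_affine (d : nat) g : g \is d.-homog -> (size (affine g) <= d.+1)%N.
Proof.
move=> hg; apply/leq_sizeP => j le_j; apply/eqP; rewrite -size_poly_eq0 -leqn0.
by apply: leq_trans (size_coef_affine j hg) _; lia.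
Qed.

Lemma size_at_infinity (d : nat) g : g \is d.-homog -> (size (at_infinity g) <= d.+1)%N.
Proof.
elim/dhomog_lin_ind => [|g1 g2 IH1 IH2|c m Em]; first by rewrite raddf0 size_poly0.
  rewrite raddfD; apply: leq_trans (size_polyD _ _) _.
  by rewrite geq_max IH1 IH2.
rewrite at_infinityX; apply: leq_trans (size_scale_leq _ _) _.
by rewrite size_polyXn -Em mdeg3; lia.
Qed.

(** Among the monomials of degree [d] only the power of the last variable has degree [d] in [y].
    Curves avoiding [(0, 0, 1)] thus have equations with invertible leading coefficient in [y]. *)
Lemma lead_affine (d : nat) g : g \is d.-homog ->
  (affine g)`_d = (g.@[point3 0 0 1])%:P.
Proof.
elim/dhomog_lin_ind => [|g1 g2 IH1 IH2|c m Em].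
- by rewrite raddf0 coef0 meval0.
- by rewrite raddfD coefD IH1 IH2 mevalD polyCD.
rewrite affineX coefCM coefXn mevalZ mevalX prod_ord3 /= expr1n mulr1 -exprD.
rewrite expr0n addn_eq0 -Em mdeg3.
case: (m i0) (m i1) => [|u] [|v]; rewrite /= ?mulr0 ?polyC0 ?mulr1 ?expr0 ?add0n ?eqxx
  ?mulr1 ?alg_polyC //;
 by rewrite gtn_eqF ?mulr0 //; lia.
Qed.

End Field.
End Dehomogenization.

(* the resultant of q (1, x, y) and g (1, x, y) with respect to y *)
Definition resultant_x (A : comNzRingType) (m d : nat) (q g : {mpoly A[3]}) :
    {poly A} :=
  \det (sylvester m d (affine q) (affine g)).

Lemma map_resultant_x (A B : comNzRingType) (phi : {rmorphism A -> B})
    (m d : nat) (q g : {mpoly A[3]}) :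
  map_poly phi (resultant_x m d q g) =
  resultant_x m d (map_mpoly phi q) (map_mpoly phi g).
Proof. by rewrite /resultant_x -!map_affine -map_sylvester det_map_mx. Qed.

(** * Elimination of [y] over a closed field *)

Section ResultantX.
Variable K : numClosedFieldType.
Local Notation S := {mpoly K[3]}.

Definition specialize_x (x : K) (g : S) : {poly K} := map_poly (horner_eval x) (affine g).

Lemma specialize_x_eval x g y : (specialize_x x g).[y] = g.@[point3 1 x y].
Proof.
by rewrite -affine_eval -[in LHS](hornerC y x) -/(horner_eval x _) horner_map.
Qed.

Lemma size_specialize_x (d : nat) x g : g \is d.-homog -> (size (specialize_x x g) <= d.+1)%N.
Proof. by move=> hg; apply: leq_trans (size_poly _ _) (size_affine hg). Qed.

Lemma resultant_x_eval m d (q g : S) x :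
  (resultant_x m d q g).[x] = \det (sylvester m d (specialize_x x q) (specialize_x x g)).
Proof. by rewrite -map_sylvester det_map_mx. Qed.

(** Since [q] does not vanish at [(0, 0, 1)], its degree in [y] is [m] above every [x]; a vanishing
    resultant then forces a common factor, hence a common root. *)
Lemma resultant_x_root (m d : nat) (q g : S) x : (0 < m)%N ->
  q \is m.-homog -> g \is d.-homog -> q.@[point3 0 0 1] != 0 ->
  reflect (exists y, q.@[point3 1 x y] = 0 /\ g.@[point3 1 x y] = 0)
    (root (resultant_x m d q g) x).
Proof.
move=> m_gt0 hq hg qv; have sq := size_specialize_x x hq; have sg := size_specialize_x x hg.
apply: (iffP idP) => [/rootP|[y []]]; last first.
  rewrite -!specialize_x_eval => qy gy; apply/rootP; rewrite resultant_x_eval.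
  by apply: (sylvester_common_root sq sg _ qy gy); rewrite addn_gt0 m_gt0 orbT.
rewrite resultant_x_eval => D0.
have sq' : size (specialize_x x q) = m.+1.
  apply/eqP; rewrite eqn_leq sq ltnNge.
  apply/negP => /leq_sizeP/(_ m (leqnn m)).
  by rewrite coef_map /= (lead_affine hq) /horner_eval hornerC => /eqP; rewrite (negPf qv).
have /closed_rootP[y] := sylvester_not_coprime sq sg sq' D0.
rewrite root_gcd => /andP[/rootP y1 /rootP y2].
by exists y; split; rewrite -specialize_x_eval; [exact: y1 | exact: y2].
Qed.

Lemma size_resultant_x (m : nat) (q1 q2 : S) : q1 \is m.-homog -> q2 \is m.-homog ->
  (size (resultant_x m m q1 q2) <= (m ^ 2).+1)%N.
Proof.
by move=> hq1 hq2; apply: size_det_sylvester => j; apply: size_coef_affine_add.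
Qed.

End ResultantX.

(** * Transversal pairs of plane curves *)

Section Homogenization.
Variable K : numFieldType.
Local Notation S := {mpoly K[3]}.
Local Notation X0 := ('X_i0 : S).
Local Notation X1 := ('X_i1 : S).
Local Notation X2 := ('X_i2 : S).

Lemma affine_homog_inj (d : nat) (g : S) : g \is d.-homog -> affine g = 0 -> g = 0.
Proof.
(* The factor [X0] disposes of the line at infinity, where the affine chart gives no information. *)
move=> hg g0; suff /eqP : X0 * g = 0.
  by rewrite mulf_eq0 (negPf (mpolyXU_neq0 _ _)) => /eqP.
apply: mpoly_eq0_meval => v; rewrite mevalM mevalXU.
have [->|v0] := eqVneq (v i0) 0; first by rewrite mul0r.
pose w := point3 1 (v i1 / v i0) (v i2 / v i0).
rewrite (_ : g.@[v] = g.@[fun i => v i0 * w i]).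
  by rewrite (meval_scale_homog _ _ hg) -affine_eval g0 !horner0 !mulr0.
apply: meval_eq => i.
by case: (ord3P i) => ->; rewrite /w /point3 /= ?mulr1 // mulrC divfK.
Qed.

Lemma at_infinity_homog_ideal (d : nat) (g : S) : g \is d.-homog ->
  at_infinity g = 0 -> adjoin1 (@zero_ideal 3 K) X0 g.
Proof.
move=> hg g0; set J := adjoin1 _ _.
have JP : is_ideal J := adjoin1_ideal X0 (@zero_idealP 3 K).
pose t : 3.-tuple S := [tuple 0; X1; X2].
have /(ideal_comp_congr g JP) := @adjoin1_X0_t0 K.
rewrite (_ : g \mPo t = 0); first by rewrite sub0r => /(idealN JP); rewrite opprK.
suff /eqP : X1 * (g \mPo t) = 0.
  by rewrite mulf_eq0 (negPf (mpolyXU_neq0 _ _)) => /eqP.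
apply: mpoly_eq0_meval => v; rewrite mevalM mevalXU comp_mpoly_meval.
have [->|v0] := eqVneq (v i1) 0; first by rewrite mul0r.
pose w := point3 0 1 (v i2 / v i1).
rewrite (_ : g.@[_] = g.@[fun i => v i1 * w i]).
  by rewrite (meval_scale_homog _ _ hg) -at_infinity_eval g0 !horner0 !mulr0.
apply: meval_eq => i; case: (ord3P i) => ->;
  by rewrite (tnth_nth 0) /w /point3 /= ?meval0 ?mevalXU ?mulr0 ?mulr1 // mulrC divfK.
Qed.

(** Homogenization is asked for in every sufficiently large degree, so that two lifts can be brought
    to a common degree and added. *)
Let lift_step (B : comNzRingType) (phi : {rmorphism S -> B}) (P : B) :=
  exists d, forall e, (d <= e)%N -> exists2 G : S, G \is e.-homog & phi G = P.

Let lift_stepD B phi P P' : lift_step (B := B) phi P -> lift_step phi P' ->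
  lift_step phi (P + P').
Proof.
move=> [d hd] [d' hd']; exists (maxn d d') => e.
rewrite geq_max => /andP[/hd[G hG <-] /hd'[G' hG' <-]].
by exists (G + G'); rewrite ?rpredD ?raddfD.
Qed.

Let lift_stepM B phi P P' : lift_step (B := B) phi P -> lift_step phi P' ->
  lift_step phi (P * P').
Proof.
move=> [d hd] [d' hd']; exists (d + d')%N => e le_e.
have [G hG <-] := hd d (leqnn d); have [G' hG' <-] := hd' (e - d)%N ltac:(lia).
exists (G * G'); last by rewrite rmorphM.
by rewrite -(@subnKC d e) ?dhomogM //; lia.
Qed.

Lemma affine_homog_surj (P : {poly {poly K}}) :
  exists d, forall e, (d <= e)%N -> exists2 G : S, G \is e.-homog & affine G = P.
Proof.
have base (c : K) : lift_step (@affine K) c%:P%:P.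
  exists 0%N => e _; exists (c *: X0 ^+ e); first by rewrite rpredZ ?dhomogXUn.
  by rewrite /= mpolyXn affineX !mulmnE !mnm1E !mul0n !expr0 mulr1 alg_polyC.
have liftX (i : 'I_3) : lift_step (@affine K) (affine ('X_i)).
  exists 1%N => -[//|e] _; exists (X0 ^+ e * 'X_i).
    by rewrite -[e.+1]addn1 dhomogM ?dhomogXU ?dhomogXUn.
  rewrite rmorphM rmorphXn /= -[X0]scale1r affineX !mnm1E /= !expr0 mulr1 alg_polyC.
  by rewrite expr1n mul1r.
have liftY : lift_step (@affine K) 'X.
  by have := liftX i2; rewrite -['X_i2]scale1r affineX !mnm1E /= expr0 scale1r mul1r expr1.
have liftx : lift_step (@affine K) 'X%:P.
  by have := liftX i1; rewrite -['X_i1]scale1r affineX !mnm1E /= expr0 scale1r mulr1 expr1.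
elim/poly_ind: P => [|P c IHP]; first exact: (base 0).
apply: (lift_stepD (phi := @affine K)); first exact: lift_stepM.
elim/poly_ind: c => [|c a IHc]; first exact: (base 0).
by rewrite polyCD polyCM; apply: (lift_stepD (phi := @affine K)); first exact: lift_stepM.
Qed.

Lemma at_infinity_homog_surj (P : {poly K}) :
  exists d, forall e, (d <= e)%N -> exists2 G : S, G \is e.-homog & at_infinity G = P.
Proof.
have base (c : K) : lift_step (@at_infinity K) c%:P.
  exists 0%N => e _; exists (c *: X1 ^+ e); first by rewrite rpredZ ?dhomogXUn.
  by rewrite /= mpolyXn at_infinityX !mulmnE !mnm1E !mul0n !expr0 mulr1 alg_polyC.
have liftX : lift_step (@at_infinity K) 'X.
  exists 1%N => -[//|e] _; exists (X1 ^+ e * X2).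
    by rewrite -[e.+1]addn1 dhomogM ?dhomogXU ?dhomogXUn.
  rewrite rmorphM rmorphXn /= -[X1]scale1r -[X2]scale1r !at_infinityX !mnm1E /= !expr0 !mulr1.
  by rewrite scale1r expr1n mul1r scale1r expr1.
elim/poly_ind: P => [|P c IHP]; first exact: (base 0).
by apply: (lift_stepD (phi := @at_infinity K)); first exact: lift_stepM.
Qed.

End Homogenization.

(** * The common points of two curves and their ideal *)

Section Points.
Variable K : numClosedFieldType.
Local Notation S := {mpoly K[3]}.
Local Notation X0 := ('X_i0 : S).
Local Notation X1 := ('X_i1 : S).
Variables (m : nat) (q1 q2 : S).
Hypotheses (m_gt0 : (0 < m)%N) (hq1 : q1 \is m.-homog) (hq2 : q2 \is m.-homog).
Hypothesis q1_vertex : q1.@[point3 0 0 1] != 0.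
Hypothesis disjoint_at_infinity :
  \det (sylvester m m (at_infinity q1) (at_infinity q2)) != 0.

(** A Bezout relation [u q1 + v q2 = 1] on the line [X0 = 0], homogenized with powers of [X1],
    becomes a relation modulo [X0]. *)
Lemma X1_nilpotent : exists M,
  adjoin1 (adjoin1 (adjoin1 (@zero_ideal 3 K) X0) q1) q2 (X1 ^+ M).
Proof.
have [|u [v E]] := sylvester_bezout (size_at_infinity hq1)
    (size_at_infinity hq2) _ disjoint_at_infinity.
  by rewrite addn_gt0 m_gt0.
have [d hd] := at_infinity_homog_surj u; have [d' hd'] := at_infinity_homog_surj v.
have [U hU Eu] := hd (maxn d d') (leq_maxl _ _).
have [V hV Ev] := hd' (maxn d d') (leq_maxr _ _).
exists (maxn d d' + m)%N; set e := (_ + m)%N.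
pose h := X1 ^+ e - U * q1 - V * q2.
have hh : h \is e.-homog.
  by rewrite !rpredB ?dhomogM ?dhomogXUn.
have h0 : at_infinity h = 0.
  rewrite !rmorphB !rmorphM rmorphXn /= Eu Ev -[X1]scale1r at_infinityX !mnm1E /=.
  by rewrite expr0 mulr1 scale1r expr1n -E -addrA -opprD subrr.
exists (h + U * q1), V; split; last by rewrite /h addrAC !subrK.
by exists h, U; split=> //; apply: at_infinity_homog_ideal hh h0.
Qed.

Let rho := resultant_x m m q1 q2.
Hypothesis rho_sep : separable_poly rho.

Let Jq12 := adjoin1 (adjoin1 (@zero_ideal 3 K) q1) q2.

Let lead_q1 : (affine q1)`_m = (q1.@[point3 0 0 1])%:P := lead_affine hq1.

Let size_affine_q1 : size (affine q1) = m.+1.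
Proof.
apply/eqP; rewrite eqn_leq size_affine //= ltnNge; apply/negP => /leq_sizeP/(_ m (leqnn m)).
by rewrite lead_q1 => /eqP; rewrite polyC_eq0 (negPf q1_vertex).
Qed.

(** The set [r] consists of the roots of [rho], and [mu] picks one common point above each. In the
    last clause, membership is obtained for the affine equations, hence up to a power of [X0], which
    is a nonzerodivisor modulo [(q1, q2)]. *)
Lemma finite_point_set : exists (r : seq K) (mu : K -> K),
  [/\ uniq r, (size r <= m ^ 2)%N,
      forall x, x \in r -> [/\ rho.[x] = 0, q1.@[point3 1 x (mu x)] = 0
        & q2.@[point3 1 x (mu x)] = 0]
    & forall (e : nat) g, g \is e.-homog ->
        (forall x, x \in r -> g.@[point3 1 x (mu x)] = 0) -> Jq12 g].
Proof.
have rho0 : rho != 0 by exact: separable_poly_neq0.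
have lrho0 : lead_coef rho != 0 by rewrite lead_coef_eq0.
have [r Er] := closed_field_poly_normal rho.
have r_uniq : uniq r.
  by rewrite -separable_prod_XsubC -(eqp_separable (eqp_scale _ lrho0)) -Er.
have r_root x : (x \in r) = root rho x.
  by rewrite Er rootZ // root_prod_XsubC.
have [x|mu hmu] := @choice K K (fun x y => x \in r ->
    q1.@[point3 1 x y] = 0 /\ q2.@[point3 1 x y] = 0).
  have [/[!r_root]/(resultant_x_root x m_gt0 hq1 hq2 q1_vertex)[y hy]|_] := boolP (x \in r).
    by exists y.
  by exists 0.
exists r, mu; split=> //.
- have := size_resultant_x hq1 hq2.
  by rewrite -/rho Er size_scale // size_prod_XsubC.
- by move=> x xr; have [? ?] := hmu x xr; split=> //; apply/rootP; rewrite -r_root.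
move=> e g hg g0.
have [A [B EAB]] : exists A B, affine g = A * affine q1 + B * affine q2.
  have ulc : lead_coef (affine q1) \is a GRing.unit.
    by rewrite lead_coefE size_affine_q1 /= lead_q1 poly_unitE size_polyC q1_vertex coefC /= unitfE.
  (* Division by [affine q1], whose leading coefficient is a unit, leaves a remainder short enough
     in [y] for Cramer's rule. *)
  have Eg := Pdiv.IdomainUnit.divp_eq ulc (affine g).
  set R := affine g %% affine q1 in Eg; set Q := affine g %/ affine q1 in Eg.
  have sR : (size R <= m + m)%N.
    have : (size R < size (affine q1))%N by rewrite ltn_modp -size_poly_gt0 size_affine_q1.
    by rewrite size_affine_q1 ltnS => /leq_trans; apply; exact: leq_addr.
  have := sylvester_cramerE (size_affine hq1) (size_affine hq2) sR.
  set c := sylvester_cramer _ _ _ _ _; rewrite -/rho => Ec.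
  have [c' Ec'] : exists c', c = rho *: c'.
    (* As [rho] has simple roots, it suffices that the cofactors vanish at each root [x]; there
       [q1], [q2] and the remainder share the zero [mu x]. *)
    suff dv k : rho %| c 0 k.
      exists (\row_k (c 0 k %/ rho)); apply/rowP => k; rewrite [RHS]mxE [X in _ * X]mxE mulrC.
      by rewrite divpK.
    rewrite Er dvdpZl // uniq_roots_dvdp ?uniq_rootsE //.
    apply/allP => x xr; apply/rootP; rewrite -/(horner_eval x _).
    have -> : horner_eval x (c 0 k) = (map_mx (horner_eval x) c) 0 k by rewrite [RHS]mxE.
    have [q1x q2x] := hmu x xr.
    rewrite map_sylvester_cramer; apply: (@sylvester_cramer_root _ _ _ _ _ _ _ _ (mu x)).
    - exact: size_specialize_x hq1.
    - exact: size_specialize_x hq2.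
    - exact: leq_trans (size_poly _ _) sR.
    - by rewrite specialize_x_eval.
    - by rewrite specialize_x_eval.
    have := specialize_x_eval x g (mu x); rewrite /specialize_x Eg.
    rewrite rmorphD rmorphM /= hornerD hornerM [X in _ * X]specialize_x_eval q1x mulr0 add0r => ->.
    exact: g0.
  have ER : R = rVpoly (lsubmx c') * affine q1 + rVpoly (rsubmx c') * affine q2.
    apply: (@mulfI _ rho%:P); first by rewrite polyC_eq0.
    by rewrite !mul_polyC Ec Ec' !linearZ /= -!scalerAl -scalerDr.
  exists (Q + rVpoly (lsubmx c')), (rVpoly (rsubmx c')).
  by rewrite Eg ER mulrDl addrA.
have [a ha] := affine_homog_surj A; have [b hb] := affine_homog_surj B.
pose d := maxn a b.
have [GA hGA EA] := ha (d + e)%N (leq_trans (leq_maxl a b) (leq_addr e _)).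
have [GB hGB EB] := hb (d + e)%N (leq_trans (leq_maxr a b) (leq_addr e _)).
have aX0 : affine X0 = 1.
  by rewrite -[X0]scale1r affineX !mnm1E /= !expr0 mulr1 scale1r.
(* With lifts of degree [d + e] both sides are forms of degree [d + m + e], and a form of given
   degree is determined by its affine equation. *)
have E : X0 ^+ (d + m) * g = GA * q1 + GB * q2.
  apply/eqP; rewrite -subr_eq0; apply/eqP; apply: (@affine_homog_inj _ (d + m + e)).
    have hX : X0 ^+ (d + m) \is (d + m).-homog by apply: dhomogXUn.
    apply: rpredB; first exact: dhomogM.
    by apply: rpredD; rewrite addnAC dhomogM.
  rewrite affineB affineD (affineM _ g) affineXn aX0 expr1n mul1r.
  by rewrite (affineM _ q1) (affineM _ q2) EA EB EAB subrr.
have {E} : Jq12 (X0 ^+ (d + m) * g).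
  by rewrite E; exists (GA * q1), GB; split=> //; exists 0, GA; rewrite add0r.
have [M X1M] := X1_nilpotent.
elim: (d + m)%N => [|k IHk]; first by rewrite mul1r.
rewrite exprS -mulrA => h; apply: IHk.
exact: (nonzerodivisor_X0 q1_vertex X1M) h.
Qed.

End Points.

(** * The Nullstellensatz for a smooth plane curve *)

Lemma mpoly_ring_ind (n : nat) (A : nzRingType) (P : {mpoly A[n]} -> Prop) :
  (forall c, P c%:MP) -> (forall i, P 'X_i) ->
  (forall g h, P g -> P h -> P (g + h)) ->
  (forall g h, P g -> P h -> P (g * h)) -> forall g, P g.
Proof.
move=> PC PX PD PM; apply: mpoly_lin_ind => [|//|c m]; first by rewrite -mpolyC0.
rewrite -mul_mpolyC; apply: (PM) => //; rewrite mpolyXE_id.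
apply: (big_ind P) => [|g h|i _]; [by rewrite -mpolyC1 | exact: (PM) |].
by elim: (m i) => [|k IH]; rewrite ?expr0 -?mpolyC1 // exprS; apply: PM.
Qed.

Lemma smooth_plane_curve_neq0 (K : fieldType) (d : nat) (f : {mpoly K[3]}) :
  smooth_plane_curve d f -> f != 0.
Proof.
move=> [_ /(_ (const_mx 1))] hf; apply/eqP => f0; move: hf; rewrite f0 meval0.
case=> [||j]; [|by []|by rewrite mderiv0 meval0 eqxx].
by apply/eqP => /rowP/(_ i0); rewrite !mxE => /eqP; rewrite oner_eq0.
Qed.

Section SmoothCurve.
Variable K : numClosedFieldType.
Local Notation S := {mpoly K[3]}.
Implicit Types (f g h : S) (x : 'I_3 -> K).

Lemma deriv_neq0_gt1 (u : {poly S}) : (1 < size u)%N -> u^`() != 0.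
Proof.
move=> su; apply/eqP => /polyP/(_ (size u).-2); rewrite coef_deriv coef0 => E.
have [v] : exists v, (lead_coef u).@[v] != 0.
  by apply: mpoly_neq0_nonroot; rewrite lead_coef_eq0 -size_poly_gt0 ltnW.
apply/negP; rewrite negbK lead_coefE.
have -> : (size u).-1 = (size u).-2.+1 by case: (size u) su => [|[]].
by have /eqP := congr1 (meval v) E; rewrite mevalMn meval0 mulrn_eq0.
Qed.

Fact specialize_key : unit. Proof. exact: tt. Qed.

(* This and the next maps are locked, since unification would otherwise
   compare their values by unfolding them. *)
Definition specialize x : {poly S} -> {poly K} :=
  locked_with specialize_key (map_poly (meval x)).

Lemma coef_specialize x p k : (specialize x p)`_k = (p`_k).@[x].
Proof. by rewrite /specialize unlock coef_map. Qed.

Lemma size_specialize x p : (size (specialize x p) <= size p)%N.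
Proof. by rewrite /specialize unlock size_poly. Qed.

Lemma specializeD x p q : specialize x (p + q) = specialize x p + specialize x q.
Proof. by rewrite /specialize unlock; exact: rmorphD. Qed.

Lemma specializeM x p q : specialize x (p * q) = specialize x p * specialize x q.
Proof. by rewrite /specialize unlock; exact: rmorphM. Qed.

Lemma specializeC x c : specialize x c%:P = (c.@[x])%:P.
Proof. by rewrite /specialize unlock map_polyC. Qed.

Lemma specializeX x : specialize x 'X = 'X.
Proof. by rewrite /specialize unlock map_polyX. Qed.

Lemma deriv_specialize x p : (specialize x p)^`() = specialize x p^`().
Proof. by rewrite /specialize unlock deriv_map. Qed.

Fact mderiv_poly_key : unit. Proof. exact: tt. Qed.

Definition mderiv_poly j : {poly S} -> {poly S} :=
  locked_with mderiv_poly_key (map_poly (mderiv j)).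

Local Notation D := mderiv_poly.

Lemma coef_mderiv_poly j p k : (D j p)`_k = (p`_k)^`M(j).
Proof. by rewrite /mderiv_poly unlock coef_map_id0 ?mderiv0. Qed.

Lemma mderiv_polyD j p q : D j (p + q) = D j p + D j q.
Proof.
by apply/polyP => k; rewrite [RHS]coefD !coef_mderiv_poly coefD mderivD.
Qed.

Lemma mderiv_polyM j p q : D j (p * q) = D j p * q + p * D j q.
Proof.
apply/polyP => k; rewrite coefD coef_mderiv_poly !coefM raddf_sum -big_split /=.
by apply: eq_bigr => i _; rewrite mderivM !coef_mderiv_poly.
Qed.

Lemma mderiv_polyC j c : D j c%:P = (c^`M(j))%:P.
Proof.
apply/polyP => k; rewrite [LHS]coef_mderiv_poly [in LHS]coefC [RHS]coefC; case: (k == 0)%N => //.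
exact: mderiv0.
Qed.

Section Translation.
Variable O : 'I_3 -> K.

Fact translate_key : unit. Proof. exact: tt. Qed.

(* f (X + Y O) as a polynomial in Y *)
Definition translate : S -> {poly S} := locked_with translate_key
  (mmap (polyC \o @mpolyC 3 K) (fun i => ('X_i)%:P + (O i)%:MP *: 'X)).

Lemma translateC c : translate c%:MP = c%:MP%:P.
Proof. by rewrite /translate unlock mmapC. Qed.

Lemma translateD : {morph translate : g h / g + h}.
Proof. by rewrite /translate unlock; exact: rmorphD. Qed.

Lemma translateM : {morph translate : g h / g * h}.
Proof. by rewrite /translate unlock; exact: rmorphM. Qed.

Lemma translateX i : translate 'X_i = ('X_i)%:P + (O i)%:MP *: 'X.
Proof. by rewrite /translate unlock mmapX mmap1U. Qed.

Lemma translate_eval g x y :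
  (specialize x (translate g)).[y] = g.@[fun i => x i + y * O i].
Proof.
elim/mpoly_ring_ind: g => [c|i|g h IHg IHh|g h IHg IHh].
- by rewrite translateC specializeC hornerC !mevalC.
- rewrite translateX -mul_polyC specializeD specializeM !specializeC specializeX.
  by rewrite hornerD hornerM !hornerC hornerX !mevalXU mevalC mulrC.
- by rewrite translateD specializeD hornerD mevalD IHg IHh.
- by rewrite translateM specializeM hornerM mevalM IHg IHh.
Qed.

Lemma translate0 g : (translate g).[0] = g.
Proof.
elim/mpoly_ring_ind: g => [c|i|g h IHg IHh|g h IHg IHh].
- by rewrite translateC hornerC.
- by rewrite translateX hornerD hornerC hornerZ hornerX mulr0 addr0.
- by rewrite translateD hornerD IHg IHh.
- by rewrite translateM hornerM IHg IHh.
Qed.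

Lemma translate_mderiv j g : D j (translate g) = translate (g^`M(j)).
Proof.
elim/mpoly_ring_ind: g => [c|i|g h IHg IHh|g h IHg IHh].
- by rewrite translateC mderivC -mpolyC0 translateC mderiv_polyC mderivC.
- rewrite translateX mderiv_polyD mderiv_polyC -mul_polyC mderiv_polyM.
  rewrite mderiv_polyC mderivC mul0r add0r.
  have -> : D j 'X = 0.
    apply/polyP => k; rewrite coef_mderiv_poly coefX coef0.
    by case: eqP => _; rewrite ?mderiv0 // -mpolyC1 mderivC.
  rewrite mulr0 addr0 mderivX mnm1E.
  have [->|_] := eqVneq i j; last by rewrite scale0r -mpolyC0 translateC.
  rewrite scale1r (_ : (_ - _)%MM = 0%MM) ?mpolyX0 -?mpolyC1 ?translateC //.
  by apply/mnmP => k; rewrite mnmBE subnn mnm0E.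
- by rewrite translateD mderivD mderiv_polyD IHg IHh translateD.
- by rewrite translateM mderiv_polyM IHg IHh mderivM translateD !translateM.
Qed.

Let top_coef (d : nat) (c : K) (p : {poly S}) := (size p <= d.+1)%N /\ p`_d = c%:MP.

Let top_coefM d d' c c' p q : top_coef d c p -> top_coef d' c' q ->
  top_coef (d + d') (c * c') (p * q).
Proof.
move=> [sp pd] [sq qd]; split.
  by apply: leq_trans (size_polyMleq _ _) _; lia.
have lt_d : (d < (d + d').+1)%N by lia.
rewrite coefM (bigD1 (Ordinal lt_d)) //= pd addKn qd mpolyCM big1 ?addr0 // => i ne.
have [lt|lt|E] := ltngtP i d.
- by rewrite [X in _ * X]nth_default ?mulr0 //; apply: leq_trans sq _; lia.
- by rewrite nth_default ?mul0r //; apply: leq_trans sp _.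
by case/eqP: ne; apply: val_inj.
Qed.

(** For [O] off the curve the translate of [f] gets a nonzero constant as leading coefficient, so
    one can divide by it in [{poly S}] without denominators. *)
Lemma translate_top (d : nat) g : g \is d.-homog ->
  (size (translate g) <= d.+1)%N /\ (translate g)`_d = (g.@[O])%:MP.
Proof.
rewrite -/(top_coef _ _ _); elim/dhomog_lin_ind => [|g1 g2 [s1 c1] [s2 c2]|c m Em].
- by rewrite /top_coef -mpolyC0 translateC mevalC mpolyC0 polyC0 size_poly0 coef0.
- rewrite /top_coef translateD coefD c1 c2 mevalD mpolyCD; split=> //.
  by apply: leq_trans (size_polyD _ _) _; rewrite geq_max s1.
rewrite -mul_mpolyC translateM mevalM mevalC /= translateC -[d]add0n -Em mdegE mpolyXE_id.
apply: top_coefM; first by rewrite /top_coef size_polyC coefC leq_b1.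
elim/big_rec2: _ => [|i e p _ IH].
  by rewrite /top_coef -mpolyC1 translateC mevalC size_polyC coefC leq_b1.
rewrite translateM mevalM; apply: top_coefM => //; elim: (m i) => [|k IHk].
  by rewrite expr0 /top_coef -mpolyC1 translateC mevalC size_polyC coefC leq_b1.
rewrite exprS translateM mevalM -[k.+1]add1n; apply: top_coefM => //.
rewrite translateX mevalXU /top_coef coefD coefC coefZ coefX mulr1 add0r; split=> //.
apply: leq_trans (size_polyD _ _) _; rewrite geq_max size_polyC.
rewrite (leq_trans (leq_b1 _)) //; apply: leq_trans (size_scale_leq _ _) _.
by rewrite size_polyX.
Qed.

Variables (d : nat) (f : S).
Hypotheses (d_gt0 : (0 < d)%N) (hf : smooth_plane_curve d f) (fO : f.@[O] != 0).

Let f_homog : f \is d.-homog. Proof. by case: hf. Qed.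

Let smooth x : (exists i, x i != 0) -> f.@[x] = 0 -> exists j, (f^`M(j)).@[x] != 0.
Proof.
move=> [i xi] fx; have ev g : g.@[(\row_k x k) 0] = g.@[x].
  by apply: meval_eq => k; rewrite mxE.
have [_ /(_ (\row_k x k))] := hf; rewrite ev => -[||j]; last by rewrite ev; exists j.
  by apply: contraNneq xi => /rowP/(_ i); rewrite !mxE => ->.
by [].
Qed.

(* The zero locus of l contains the line through O. *)
Let off_center : exists2 l : S, l != 0 & forall x y, l.@[x] != 0 ->
  exists i, x i + y * O i != 0.
Proof.
have [i Oi] : exists i, O i != 0.
  apply/existsP; apply: contraR fO => /existsPn O0.
  rewrite (@meval_eq _ _ _ (fun j => 0 * O j)) => [|j].
    by rewrite (meval_scale_homog _ _ f_homog) expr0n eqn0Ngt d_gt0 mul0r.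
  by rewrite mul0r; apply/eqP; rewrite -[_ == _]negbK O0.
pose k : 'I_3 := if i == i0 then i1 else i0.
have ki : k != i by rewrite /k; have [->|ne] := eqVneq i i0; rewrite // eq_sym.
exists ((O i) *: 'X_k - (O k) *: 'X_i).
  apply/eqP => /mpolyP/(_ U_(k)%MM); rewrite mcoeff0 mcoeffB !mcoeffZ !mcoeffXU.
  by rewrite eqxx eq_sym (negPf ki) mulr1 mulr0 subr0 => /eqP; rewrite (negPf Oi).
move=> x y; rewrite mevalB !mevalZ !mevalXU => lx; apply/existsP.
apply: contraR lx => /existsPn x0.
have E j : x j = - (y * O j) by apply/eqP; rewrite -addr_eq0; have := x0 j; rewrite negbK.
by rewrite !E; apply/eqP; ring.
Qed.

Let F := translate f.

Let size_F : size F = d.+1.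
Proof.
have [sF cF] := translate_top f_homog; apply/eqP; rewrite eqn_leq sF ltnNge.
apply/negP => /leq_sizeP/(_ d (leqnn d))/eqP.
by rewrite cF mpolyC_eq0 (negPf fO).
Qed.

Let F_neq0 : F != 0. Proof. by rewrite -size_poly_gt0 size_F. Qed.

(* Up to a factor c in S, a double factor of F divides every translated partial
   derivative of f, so its roots would be singular points of the curve. *)
Let F_squarefree (u : {poly S}) : size u != 1%N -> ~~ (u ^+ 2 %| F).
Proof.
move=> su; apply/negP => /Pdiv.Idomain.dvdpP[[c b]] /= c0 E.
have u0 : u != 0.
  apply: contraNneq F_neq0 => u0; move/eqP: E.
  by rewrite u0 expr0n mulr0 -mul_polyC mulf_eq0 polyC_eq0 (negPf c0).
have {}su : (1 < size u)%N by rewrite ltn_neqAle eq_sym su size_poly_gt0.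
rewrite expr2 -mul_polyC in E.
have [l l0 hl] := off_center.
(* At such an [x] the factor [c] and the degree of [u] survive, and the line through [x] in the
   direction [O] avoids the origin. *)
have [x] : exists x, (c * lead_coef u * l).@[x] != 0.
  by apply: mpoly_neq0_nonroot; rewrite !mulf_neq0 ?lead_coef_eq0.
rewrite !mevalM !mulf_eq0 !negb_or => /andP[/andP[cx ux] lx].
have [y uy] : exists y, root (specialize x u) y.
  apply/closed_rootP; have : (specialize x u)`_(size u).-1 != 0.
    rewrite coef_specialize; exact: ux.
  apply: contraNneq => s1; rewrite nth_default // s1.
  by case: (size u) su => [|[]].
pose p i := x i + y * O i.
pose at_p a := (specialize x a).[y].
have evM a1 a2 : at_p (a1 * a2) = at_p a1 * at_p a2 by rewrite /at_p specializeM hornerM.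
have evD a1 a2 : at_p (a1 + a2) = at_p a1 + at_p a2 by rewrite /at_p specializeD hornerD.
have evT g : at_p (translate g) = g.@[p] by rewrite /at_p translate_eval.
have evC a : at_p a%:P = a.@[x] by rewrite /at_p specializeC hornerC.
have evu : at_p u = 0 by apply/rootP.
have fp : f.@[p] = 0.
  apply/eqP; have /eqP := congr1 at_p E.
  by rewrite !evM evC evu !mulr0 evT mulf_eq0 (negPf cx).
have [j] := smooth (hl x y lx) fp; apply/negP; rewrite negbK.
have /eqP := congr1 (fun q => at_p (D j q)) E.
rewrite !mderiv_polyM !(evM, evD) evu !(mul0r, mulr0, addr0).
rewrite mderiv_polyC !evC translate_mderiv !evT fp mulr0 add0r.
by rewrite mulf_eq0 (negPf cx).
Qed.

Let F_separable : separable_poly F.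
Proof.
apply/separable_polyP; split; first exact/poly_square_freeP.
by move=> u _; apply: deriv_neq0_gt1.
Qed.

(* On a general line through O, h vanishes at the d distinct points of the
   curve, so the remainder of h (X + Y O) modulo f (X + Y O) is zero. *)
Lemma smooth_curve_divides_off (e : nat) h : h \is e.-homog ->
  (forall x, (exists i, x i != 0) -> f.@[x] = 0 -> h.@[x] = 0) ->
  exists u, h = u * f.
Proof.
move=> hh hvan; pose H := translate h.
have lF : lead_coef F = (f.@[O])%:MP by rewrite lead_coefE size_F; case: (translate_top f_homog).
have ulF : lead_coef F \is a GRing.unit by rewrite lF rmorph_unit // unitfE.
have EH := Pdiv.IdomainUnit.divp_eq ulF H.
set Q := H %/ F in EH; set R := H %% F in EH.
suff R0 : R = 0.
  exists Q.[0]; rewrite -[LHS]translate0 -/H EH R0 addr0 hornerM.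
  by rewrite /F translate0.
apply/eqP/negPn/negP => R_neq0.
have sR : (size R <= d)%N by rewrite -ltnS -size_F ltn_modp.
(* Without denominators, separability is a relation [U F + V F' = r] with [r] a nonzero element of
   [S]; the fibre over [x] stays separable wherever [r] does not vanish. *)
have := F_separable; rewrite unlock => /Bezout_coprimepP[[U V] /=].
rewrite -size_poly_eq1 => /size_poly1P[r r0 Er].
have [l l0 hl] := off_center.
have [x] : exists x, (r * lead_coef R * l).@[x] != 0.
  by apply: mpoly_neq0_nonroot; rewrite !mulf_neq0 ?lead_coef_eq0.
rewrite !mevalM !mulf_eq0 !negb_or => /andP[/andP[rx Rx] lx].
pose ev := specialize x.
have sFx : size (ev F) = d.+1.
  apply/eqP; rewrite eqn_leq (leq_trans (size_specialize _ _)) ?size_F //= ltnNge.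
  apply/negP => /leq_sizeP/(_ d (leqnn d))/eqP.
  by rewrite coef_specialize -[d]/(d.+1.-1) -size_F -lead_coefE lF mevalC (negPf fO).
have Fx_sep : separable_poly (ev F).
  rewrite unlock; apply/Bezout_coprimepP; exists (ev U, ev V) => /=.
  rewrite /ev deriv_specialize -!specializeM -specializeD Er specializeC.
  by rewrite polyC_eqp1.
have lFx : lead_coef (ev F) != 0 by rewrite lead_coef_eq0 -size_poly_gt0 sFx.
have [s Es] := closed_field_poly_normal (ev F).
have s_uniq : uniq s.
  by rewrite -separable_prod_XsubC -(eqp_separable (eqp_scale _ lFx)) -Es.
have ss : size s = d.
  by apply: succn_inj; rewrite -sFx Es size_scale // size_prod_XsubC.
have Rx0 : ev R != 0.
  apply: contraNneq Rx => /polyP/(_ (size R).-1).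
  by rewrite coef_specialize coef0 lead_coefE => ->.
have : all (root (ev R)) s.
  apply/allP => y ys; have Fy : (ev F).[y] = 0.
    by apply/rootP; rewrite Es rootZ // root_prod_XsubC.
  have : (ev H).[y] = 0.
    rewrite /ev translate_eval; apply: hvan; first exact: hl.
    by rewrite -translate_eval.
  rewrite EH /ev specializeD specializeM hornerD hornerM -/(ev F) Fy mulr0 add0r.
  by move/rootP.
move/(max_poly_roots Rx0)/(_ s_uniq); rewrite ss ltnNge.
by rewrite (leq_trans (size_specialize _ _)).
Qed.

End Translation.

Lemma smooth_curve_divides (d e : nat) f h : (0 < d)%N ->
  smooth_plane_curve d f -> h \is e.-homog ->
  (forall p : 'rV[K]_3, p != 0 -> f.@[p 0] = 0 -> h.@[p 0] = 0) ->
  exists u, h = u * f.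
Proof.
move=> d_gt0 hf hh hvan.
have [O fO] := mpoly_neq0_nonroot (smooth_plane_curve_neq0 hf).
apply: (smooth_curve_divides_off d_gt0 hf fO hh) => x [i xi].
have ev g : g.@[(\row_k x k) 0] = g.@[x] by apply: meval_eq => k; rewrite mxE.
rewrite -!ev; apply: hvan; apply: contraNneq xi => /rowP/(_ i).
by rewrite !mxE => ->.
Qed.

End SmoothCurve.

Lemma interpolation (K : fieldType) (r : seq K) (v : K -> K) : uniq r ->
  exists2 p : {poly K}, (size p <= size r)%N & forall x, x \in r -> p.[x] = v x.
Proof.
elim: r => [|a r IH] /=; first by exists 0; rewrite ?size_poly0.
move=> /andP[ar /IH[p sp pv]].
pose w := \prod_(z <- r) ('X - z%:P).
have wa : w.[a] != 0 by rewrite -rootE root_prod_XsubC.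
exists (p + ((v a - p.[a]) / w.[a]) *: w).
  apply: leq_trans (size_polyD _ _) _; rewrite geq_max (leq_trans sp) //=.
  by apply: leq_trans (size_scale_leq _ _) _; rewrite size_prod_XsubC.
move=> x; rewrite inE hornerD hornerZ => /orP[/eqP ->|xr].
  by rewrite divfK // addrC subrK.
have /rootP -> : root w x by rewrite root_prod_XsubC.
by rewrite mulr0 addr0 pv.
Qed.

(** * Adding a curve that avoids the points *)

Section PointsAndCurve.
Variable K : numClosedFieldType.
Local Notation S := {mpoly K[3]}.
Local Notation X0 := ('X_i0 : S).
Local Notation X1 := ('X_i1 : S).
Variables (m d : nat) (q1 q2 f : S) (r : seq K) (mu : K -> K).
Hypotheses (m_gt0 : (0 < m)%N) (hq1 : q1 \is m.-homog) (hq2 : q2 \is m.-homog).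
Hypotheses (d_gt0 : (0 < d)%N) (hf : f \is d.-homog) (r_uniq : uniq r).
Hypothesis q_points : forall x, x \in r ->
  q1.@[point3 1 x (mu x)] = 0 /\ q2.@[point3 1 x (mu x)] = 0.
Hypothesis f_points : forall x, x \in r -> f.@[point3 1 x (mu x)] != 0.

Let Jq12 := adjoin1 (adjoin1 (@zero_ideal 3 K) q1) q2.

Hypothesis points_ideal : forall (e : nat) g, g \is e.-homog ->
  (forall x, x \in r -> g.@[point3 1 x (mu x)] = 0) -> Jq12 g.

Let Jq12P : is_ideal Jq12.
Proof. by do 2!apply: adjoin1_ideal; apply: zero_idealP. Qed.

Let Jq12_homog : homogeneous Jq12.
Proof.
apply: adjoin1_homogeneous hq2; first exact: adjoin1_ideal (@zero_idealP _ _).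
apply: adjoin1_homogeneous hq1; first exact: zero_idealP.
exact: zero_ideal_homogeneous.
Qed.

Lemma ideal_vanishes_on_points g x : Jq12 g -> x \in r -> g.@[point3 1 x (mu x)] = 0.
Proof.
move=> [_ [v [[_ [u [-> ->]]] ->]]] /q_points[q1x q2x].
by rewrite add0r mevalD !mevalM q1x q2x !mulr0 addr0.
Qed.

(** A form vanishing on the points is in [(q1, q2)], and [f] vanishes at none of them. *)
Lemma curve_nonzerodivisor : nonzerodivisor_mod Jq12 f.
Proof.
move=> h Jfh; apply: ideal_components => // k.
apply: (points_ideal (pihomogP mdeg k h)) => x xr.
have /(ideal_vanishes_on_points)/(_ xr)/eqP := Jq12_homog (d + k) Jfh.
rewrite mulrC (pihomogM_hom _ _ hf) mevalM mulf_eq0 (negPf (f_points xr)) orbF.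
by move/eqP.
Qed.

Let J := adjoin1 Jq12 f.

(** The points have distinct abscissas, so in large degree a form in [X0, X1] interpolates [h / f]
    on them; subtracting its multiple by [f] leaves a form vanishing on the points, hence in
    [(q1, q2)]. *)
Lemma points_curve_artinian : exists e, forall h k, (e <= k)%N -> h \is k.-homog -> J h.
Proof.
exists (d + size r)%N => h k le_k hh.
have [p sp hp] := interpolation (fun x => h.@[point3 1 x (mu x)] / f.@[point3 1 x (mu x)]) r_uniq.
have le_dk : (d <= k)%N := leq_trans (leq_addr _ _) le_k.
have le_r : (size r <= k - d)%N by rewrite leq_subRL.
pose G : S := \sum_(i < size p) p`_i *: (X0 ^+ (k - d - i) * X1 ^+ i).
have hG : G \is (k - d).-homog.
  apply: rpred_sum => i _; apply: rpredZ; have lt_i := leq_trans (ltn_ord i) sp.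
  have := dhomogM (dhomogXUn K i0 (k - d - i)) (dhomogXUn K i1 i).
  by rewrite subnK // ltnW // (leq_trans lt_i le_r).
exists (h - G * f), G; split; last by rewrite subrK.
have kd : (k = k - d + d)%N by rewrite subnK.
apply: (points_ideal (e := k)); first by rewrite rpredB // {1}kd dhomogM.
move=> x xr; rewrite mevalB mevalM.
have -> : G.@[point3 1 x (mu x)] = p.[x].
  rewrite horner_coef /G raddf_sum; apply: eq_bigr => i _ /=.
  by rewrite mevalZ mevalM !rmorphXn /= !mevalXU expr1n mul1r.
by rewrite hp // divfK ?subrr // f_points.
Qed.

Lemma points_curve_socle M : q1.@[point3 0 0 1] != 0 ->
  adjoin1 (adjoin1 (adjoin1 (@zero_ideal 3 K) X0) q1) q2 (X1 ^+ M) ->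
  socle_dim1_in_degree J (m + m + d - 3).
Proof.
move=> q1v X1M; apply: complete_intersection_socle => //; first exact: X1M.
exact: curve_nonzerodivisor.
Qed.

End PointsAndCurve.

(** * Genericity *)

Lemma lead_at_infinity (K : fieldType) (d : nat) (g : {mpoly K[3]}) :
  g \is d.-homog -> (at_infinity g)`_d = g.@[point3 0 0 1].
Proof.
elim/dhomog_lin_ind => [|g1 g2 IH1 IH2|c m Em].
- by rewrite raddf0 coef0 meval0.
- by rewrite raddfD coefD IH1 IH2 mevalD.
rewrite at_infinityX coefZ coefXn mevalZ mevalX prod_ord3 /= expr1n mulr1 -mulrA.
congr (_ * _); rewrite -Em mdeg3.
case: (m i0) (m i1) => [|u] [|v]; rewrite /= ?expr0 ?mul1r ?eqxx ?expr0n ?mul0r //.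
by rewrite gtn_eqF //; lia.
Qed.

Section Form.
Variables (K : fieldType) (m n : nat).
Hypothesis n_monoms : n = size (monoms m).

(** The coefficient ring is arbitrary because the same form is also needed with indeterminate
    coefficients. *)
Definition form (A : comNzRingType) (a : 'I_n -> A) : {mpoly A[3]} :=
  \sum_i a i *: 'X_[nth 0%MM (monoms m) i].

Lemma form_homog (a : 'I_n -> K) : form a \is m.-homog.
Proof.
apply: rpred_sum => i _; apply: rpredZ; rewrite dhomogX /=.
by have := ltn_ord i; rewrite [X in (_ < X)%N]n_monoms => /(mem_nth 0%MM); rewrite mem_monoms.
Qed.

Lemma form_surj (q : {mpoly K[3]}) : q \is m.-homog ->
  exists a : 'rV[K]_n, q = form (a 0).
Proof.
elim/dhomog_lin_ind => [|g1 g2 [a1 ->] [a2 ->]|c k Ek].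
- by exists 0; rewrite /form big1 // => i _; rewrite mxE scale0r.
- exists (a1 + a2); rewrite /form -big_split; apply: eq_bigr => i _.
  by rewrite mxE scalerDl.
have km : k \in monoms m by rewrite mem_monoms Ek.
have lt_i : (index k (monoms m) < n)%N by rewrite n_monoms index_mem.
exists (\row_j (if j == Ordinal lt_i then c else 0)).
rewrite /form (bigD1 (Ordinal lt_i)) //= big1 => [|j ne].
  by rewrite mxE eqxx nth_index // addr0.
by rewrite mxE (negPf ne) scale0r.
Qed.

End Form.

Lemma map_form (m n : nat) (A B : comNzRingType) (phi : {rmorphism A -> B})
  (a : 'I_n -> A) : map_mpoly phi (form m a) = form m (phi \o a).
Proof. by rewrite raddf_sum; apply: eq_bigr => i _; rewrite /= map_mpolyZX. Qed.

(** * An explicit pair made of lines *)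

Section Example.
Variable K : numClosedFieldType.
Local Notation S := {mpoly K[3]}.
Local Notation X0 := ('X_i0 : S).
Local Notation X1 := ('X_i1 : S).
Local Notation X2 := ('X_i2 : S).

Lemma distinct_nonroots (p : {poly K}) (m : nat) : p != 0 ->
  exists s, [/\ size s = m, uniq s & forall c, c \in s -> p.[c] != 0].
Proof.
move=> p0; elim: m => [|m [s [ss us ps]]]; first by exists [::].
have w0 : p * \prod_(z <- s) ('X - z%:P) != 0.
  by rewrite mulf_neq0 // monic_neq0 ?monic_prod_XsubC.
have [t] := poly_neq0_nonroot w0; rewrite hornerM mulf_eq0 negb_or => /andP[pt].
rewrite -rootE root_prod_XsubC => ts; exists (t :: s); split=> /=.
- by rewrite ss.
- by rewrite ts.
by move=> c; rewrite inE => /orP[/eqP ->|/ps].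
Qed.

(** The sums will be the abscissas of the common points of two families of lines, and the zeros of
    [p] the abscissas to avoid. *)
Lemma distinct_sums (p : {poly K}) (cs : seq K) (m : nat) : p != 0 -> uniq cs ->
  exists s, [/\ size s = m, uniq [seq c + e | e <- s, c <- cs]
    & forall e c, e \in s -> c \in cs -> p.[c + e] != 0].
Proof.
move=> p0 ucs; elim: m => [|m [s [ss us ps]]]; first by exists [::].
set L := [seq _ | _ <- s, _ <- cs] in us.
(* A nonroot [t] of [w1] keeps every [t + c] off the roots of [p]; a nonroot of [w2] keeps it off
   the earlier sums. *)
pose w1 := \prod_(c <- cs) (p \Po ('X + c%:P)).
pose w2 : {poly K} := \prod_(c <- cs) \prod_(l <- L) ('X - (l - c)%:P).
have w0 : w1 * w2 != 0.
  apply: mulf_neq0; rewrite prodf_seq_neq0; apply/allP => c _ /=.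
    by rewrite -size_poly_gt0 size_comp_poly2 ?size_XaddC // size_poly_gt0.
  by rewrite -(big_map (fun l => l - c) xpredT (fun z => 'X - z%:P)) monic_neq0 ?monic_prod_XsubC.
have [t] := poly_neq0_nonroot w0.
rewrite hornerM mulf_eq0 negb_or !horner_prod !prodf_seq_neq0 => /andP[/allP h1 /allP h2].
exists (t :: s); split=> /=; first by rewrite ss.
  rewrite cat_uniq us andbT map_inj_uniq ?ucs /=; last exact: addIr.
  apply/hasPn => l lL; apply/mapP => -[c ccs El].
  have := h2 _ ccs; rewrite /= horner_prod prodf_seq_neq0 => /allP/(_ _ lL)/=.
  by rewrite hornerXsubC El addrAC subrr add0r subrr eqxx.
move=> e c; rewrite inE => /orP[/eqP -> ccs|/ps]; last exact.
by have := h1 _ ccs; rewrite /= horner_comp hornerD hornerX hornerC addrC.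
Qed.

(** The line with parameter [c] here and the line with parameter [e] of [diagonal_lines] meet at
    [(1, c + e, c)]. *)
Definition horizontal_lines (cs : seq K) : S := \prod_(c <- cs) (X2 - c *: X0).

Definition diagonal_lines (es : seq K) : S := \prod_(e <- es) (X1 - X2 - e *: X0).

Lemma prod_lines_homog (s : seq K) (l : K -> S) : (forall c, l c \is 1.-homog) ->
  \prod_(c <- s) l c \is (size s).-homog.
Proof.
move=> hl; elim: s => [|c s IH]; first by rewrite big_nil dhomog1.
rewrite big_cons; exact: (dhomogM (hl c) IH).
Qed.

Lemma horizontal_lines_homog cs : horizontal_lines cs \is (size cs).-homog.
Proof. by apply: prod_lines_homog => c; rewrite rpredB ?rpredZ ?dhomogXU. Qed.

Lemma diagonal_lines_homog es : diagonal_lines es \is (size es).-homog.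
Proof. by apply: prod_lines_homog => c; rewrite !rpredB ?rpredZ ?dhomogXU. Qed.

Lemma horizontal_lines_eval cs x y z :
  (horizontal_lines cs).@[point3 x y z] = \prod_(c <- cs) (z - c * x).
Proof.
rewrite rmorph_prod; apply: eq_bigr => c _ /=.
by rewrite mevalB mevalZ !mevalXU.
Qed.

Lemma diagonal_lines_eval es x y z :
  (diagonal_lines es).@[point3 x y z] = \prod_(e <- es) (y - z - e * x).
Proof.
rewrite rmorph_prod; apply: eq_bigr => e _ /=.
by rewrite !mevalB mevalZ !mevalXU.
Qed.

End Example.

Section GoodPairExample.
Variable K : numClosedFieldType.
Local Notation S := {mpoly K[3]}.

(* The coprimality says that the common points of q1 and q2 have distinct
   x-coordinates, and that f and q1 have no common zero above any of these. *)
Definition good_pair (m d : nat) (f q1 q2 : S) : Prop :=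
  [/\ q1.@[point3 0 0 1] != 0,
      \det (sylvester m m (at_infinity q1) (at_infinity q2)) != 0
    & coprimep (resultant_x m m q1 q2)
        ((resultant_x m m q1 q2)^`() * resultant_x m d q1 f)].

Lemma good_pair_exists (m d : nat) (f : S) : (0 < m)%N -> f \is d.-homog -> f != 0 ->
  exists q1 q2, [/\ q1 \is m.-homog, q2 \is m.-homog, good_pair m d f q1 q2
    & size (resultant_x m m q1 q2) = (m ^ 2).+1].
Proof.
move=> m_gt0 hf f0.
have F0 : affine f != 0 by apply: contra f0 => /eqP/(affine_homog_inj hf)->.
(* A vertical line not contained in the curve. If [c] is not the height of a point of the curve on
   it, the line [X2 = c X0] is no component of the curve; hence [p != 0] below. *)
have [x0 Fx0] : exists x0, specialize_x x0 f != 0.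
  have [x0 hx0] : exists x0, (lead_coef (affine f)).[x0] != 0.
    by apply: poly_neq0_nonroot; rewrite lead_coef_eq0.
  exists x0; apply: contraNneq hx0 => /polyP/(_ (size (affine f)).-1).
  by rewrite coef_map coef0 /= /horner_eval lead_coefE => ->.
have [cs [scs ucs Fcs]] := distinct_nonroots m Fx0.
pose p : {poly K} := \prod_(c <- cs) (affine f).[c%:P].
have p0 : p != 0.
  rewrite prodf_seq_neq0; apply/allP => c /Fcs /=; apply: contraNneq => E.
  by rewrite specialize_x_eval -affine_eval E horner0.
have [es [ses uL pes]] := distinct_sums m p0 ucs.
set L := [seq _ | _ <- es, _ <- cs] in uL.
pose q1 := horizontal_lines cs; pose q2 := diagonal_lines es.
have hq1 : q1 \is m.-homog by rewrite -scs horizontal_lines_homog.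
have hq2 : q2 \is m.-homog by rewrite -ses diagonal_lines_homog.
have q1v : q1.@[point3 0 0 1] != 0.
  rewrite horizontal_lines_eval prodf_seq_neq0; apply/allP => c _ /=.
  by rewrite mulr0 subr0 oner_neq0.
pose rho := resultant_x m m q1 q2.
have root_q1 x y : q1.@[point3 1 x y] = 0 -> y \in cs.
  move/eqP; rewrite horizontal_lines_eval prodf_seq_eq0 => /hasP[c ccs] /=.
  by rewrite mulr1 subr_eq0 => /eqP ->.
have root_rho x : root rho x = (x \in L).
  apply/(resultant_x_root x m_gt0 hq1 hq2 q1v)/allpairsP.
    move=> [y [/root_q1 ycs /eqP]]; rewrite diagonal_lines_eval prodf_seq_eq0.
    move=> /hasP[e ees] /=; rewrite mulr1 => /eqP E; exists (e, y); split=> //=.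
    by apply/eqP; rewrite -subr_eq0 opprD addrA E.
  move=> [[e c] /= [ees ccs ->]]; exists c; split; apply/eqP.
    rewrite horizontal_lines_eval prodf_seq_eq0; apply/hasP; exists c => //=.
    by rewrite mulr1 subrr.
  rewrite diagonal_lines_eval prodf_seq_eq0; apply/hasP; exists e => //=.
  by rewrite mulr1 addrAC addrK subrr.
have rho0 : rho != 0.
  have [x] : exists x, (\prod_(z <- L) ('X - z%:P)).[x] != 0.
    by apply: poly_neq0_nonroot; rewrite monic_neq0 ?monic_prod_XsubC.
  rewrite -rootE root_prod_XsubC -root_rho; apply: contraNneq => ->.
  exact: root0.
(* The [m ^ 2] distinct sums are roots of [rho], whose degree is at most [m ^ 2]: this gives both
   its exact degree and the simplicity of its roots. *)
have sL : size L = (m ^ 2)%N by rewrite size_allpairs scs ses.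
have allL : all (root rho) L by apply/allP => x; rewrite root_rho.
have srho : size rho = (m ^ 2).+1.
  apply/eqP; rewrite eqn_leq size_resultant_x //= -sL.
  exact: max_poly_roots rho0 allL uL.
have rho_sep : separable_poly rho.
  have dv : \prod_(z <- L) ('X - z%:P) %| rho.
    by apply: uniq_roots_dvdp => //; rewrite uniq_rootsE.
  have : \prod_(z <- L) ('X - z%:P) %= rho.
    by rewrite -dvdp_size_eqp // size_prod_XsubC sL srho.
  by move/eqp_separable => <-; rewrite separable_prod_XsubC.
exists q1, q2; split=> //; split=> //.
  (* On the line [X0 = 0] the two curves are [X2 ^ m] and [(X1 - X2) ^ m], which share no zero. *)
  have sq1 : size (at_infinity q1) = m.+1.
    apply/eqP; rewrite eqn_leq size_at_infinity //= ltnNge.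
    apply/negP => /leq_sizeP/(_ m (leqnn m))/eqP.
    by rewrite lead_at_infinity // (negPf q1v).
  apply/eqP => /(sylvester_not_coprime (size_at_infinity hq1) (size_at_infinity hq2) sq1).
  apply/negP; rewrite negbK; apply/Pdiv.ClosedField.coprimepP => y.
  rewrite !rootE !at_infinity_eval horizontal_lines_eval diagonal_lines_eval.
  rewrite prodf_seq_eq0 => /hasP[c _] /=; rewrite mulr0 subr0 => /eqP ->.
  by rewrite prodf_seq_neq0; apply/allP => e _ /=; rewrite mulr0 !subr0 oner_neq0.
rewrite coprimepMr; apply/andP; split; first by move: rho_sep; rewrite unlock.
apply/Pdiv.ClosedField.coprimepP => x; rewrite -/rho root_rho => /allpairsP[[e c] /= [ees ccs ->]].
apply/(resultant_x_root _ m_gt0 hq1 hf q1v) => -[y [/root_q1 ycs fy]].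
have := pes e c ees ccs; rewrite /p horner_prod prodf_seq_neq0 => /allP/(_ y ycs)/=.
by rewrite affine_eval fy eqxx.
Qed.

End GoodPairExample.

(** The resultants are formed once, for forms with indeterminate coefficients, and commute with
    specialization; each factor of [G] expresses one condition of [good_pair], and the explicit pair
    shows that [G] is nonzero. *)
Lemma general_good_pair (K : numClosedFieldType) (m d n : nat) (f : {mpoly K[3]}) :
  (0 < m)%N -> n = size (monoms m) -> f \is d.-homog -> f != 0 ->
  exists2 G : {mpoly K[n + n]}, G != 0 & forall a b : 'rV[K]_n,
    G.@[row_mx a b 0] != 0 -> good_pair m d f (form m (a 0)) (form m (b 0)).
Proof.
move=> m_gt0 En hf f0; pose C := {mpoly K[n + n]}.
pose Q1 : {mpoly C[3]} := form m (fun i => 'X_(lshift n i)).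
pose Q2 : {mpoly C[3]} := form m (fun i => 'X_(rshift n i)).
pose F : {mpoly C[3]} := map_mpoly (@mpolyC (n + n) K) f.
pose rho : {poly C} := resultant_x m m Q1 Q2.
pose t : {poly C} := rho^`() * resultant_x m d Q1 F.
pose Ginf : C := \det (sylvester m m (at_infinity Q1) (at_infinity Q2)).
(* Under every specialization [m ^ 2] bounds the degree of [rho] and [size t] that of [t]; the first
   bound is attained by the explicit pair. *)
pose Gx : C := \det (sylvester (m ^ 2) (size t) rho t).
pose G : C := (affine Q1)`_m`_0 * Ginf * Gx.
have mapQ1 (a b : 'rV[K]_n) : map_mpoly (meval (row_mx a b 0)) Q1 = form m (a 0).
  rewrite map_form; apply: eq_bigr => i _; congr (_ *: _).
  by rewrite /= mevalXU row_mxEl.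
have mapQ2 (a b : 'rV[K]_n) : map_mpoly (meval (row_mx a b 0)) Q2 = form m (b 0).
  rewrite map_form; apply: eq_bigr => i _; congr (_ *: _).
  by rewrite /= mevalXU row_mxEr.
have mapF (v : 'I_(n + n) -> K) : map_mpoly (meval v) F = f.
  by apply/mpolyP => k; rewrite !mcoeff_map_mpoly /= mevalC.
have mapt (a b : 'rV[K]_n) (q1 := form m (a 0)) (q2 := form m (b 0)) :
    map_poly (meval (row_mx a b 0)) t =
    (resultant_x m m q1 q2)^`() * resultant_x m d q1 f.
  rewrite [LHS]rmorphM; congr (_ * _).
    rewrite -[LHS]deriv_map; congr (_^`()).
    by rewrite [LHS]map_resultant_x mapQ1 mapQ2.
  by rewrite [LHS]map_resultant_x mapQ1 mapF.
have GE (a b : 'rV[K]_n) (q1 := form m (a 0)) (q2 := form m (b 0)) (rho0 := resultant_x m m q1 q2) :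
    G.@[row_mx a b 0] = q1.@[point3 0 0 1] *
      \det (sylvester m m (at_infinity q1) (at_infinity q2)) *
      \det (sylvester (m ^ 2) (size t) rho0 (rho0^`() * resultant_x m d q1 f)).
  rewrite !mevalM; congr (_ * _ * _).
  - transitivity (map_poly (map_poly (meval (row_mx a b 0))) (affine Q1))`_m`_0.
      by rewrite !coef_map.
    by rewrite map_affine mapQ1 (lead_affine (form_homog En _)) coefC.
  - rewrite [LHS]map_det_sylvester; congr (\det (sylvester _ _ _ _)).
      by rewrite [LHS]map_at_infinity mapQ1.
    by rewrite [LHS]map_at_infinity mapQ2.
  rewrite [LHS]map_det_sylvester mapt; congr (\det (sylvester _ _ _ _)).
  by rewrite [LHS]map_resultant_x mapQ1 mapQ2.
have size_t (a b : 'rV[K]_n) : (size (map_poly (meval (row_mx a b 0%R)) t) <= (size t).+1)%N.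
  exact: leq_trans (size_poly _ _) (leqnSn _).
exists G.
  have [q1 [q2 [hq1 hq2 [q1v qinf qx] srho]]] := good_pair_exists m_gt0 hf f0.
  have [a Ea] := form_surj En hq1; have [b Eb] := form_surj En hq2.
  suff : G.@[row_mx a b 0] != 0 by apply: contraNneq => ->; rewrite meval0.
  rewrite GE -Ea -Eb !mulf_neq0 //; apply: contraL qx => /eqP D0.
  have st : (size ((resultant_x m m q1 q2)^`() * resultant_x m d q1 f)%R <= (size t).+1)%N.
    by have := size_t a b; rewrite mapt -Ea -Eb.
  by apply: (sylvester_not_coprime _ st srho D0); rewrite srho.
move=> a b; rewrite GE !mulf_eq0 !negb_or => /andP[/andP[q1v qinf] D0].
split=> //; set rho0 := resultant_x _ _ _ _ in D0 *.
have srho : (size rho0 <= (m ^ 2).+1)%N by apply: size_resultant_x; apply: form_homog.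
have [||u [v E]] := sylvester_bezout srho _ _ D0.
- by rewrite -mapt size_t.
- by rewrite addn_gt0 expn_gt0 m_gt0 orbT.
by apply/Bezout_coprimepP; exists (u, v); rewrite /= E eqpxx.
Qed.

(** * Graded Gorenstein ideals *)

Section SubspaceChain.
Variables (K : fieldType) (n : nat) (U : nat -> 'rV[K]_n -> Prop).
Hypothesis U0 : forall k, U k 0.
Hypothesis UD : forall k u v, U k u -> U k v -> U k (u + v).
Hypothesis UZ : forall k c u, U k u -> U k (c *: u).
Hypothesis U_decr : forall k u, U k.+1 u -> U k u.

Let U_le k l u : (k <= l)%N -> U l u -> U k u.
Proof.
by move=> /subnK <-; elim: (l - k)%N => // i IH; rewrite addSn => /U_decr/IH.
Qed.

Let U_submx k (m : nat) (A : 'M[K]_(m, n)) u :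
  (forall i, U k (row i A)) -> (u <= A)%MS -> U k u.
Proof.
move=> UA /submxP[c ->]; rewrite mulmx_sum_row.
apply: (big_ind (U k)) => [||i _]; [exact: U0 | exact: UD | exact/UZ/UA].
Qed.

(** Let [r] be least such that some [U k] has no more than [r] independent vectors. Every later
    [U l] still contains [r] of them, and an element of [U k] outside their span would exceed the
    bound. *)
Lemma subspace_chain_stationary :
  exists k, forall l, (k <= l)%N -> forall u, U k u -> U l u.
Proof.
pose bound r := exists k, forall A : 'M[K]_n, (forall i, U k (row i A)) -> (\rank A <= r)%N.
have bound_n : bound n by exists 0%N => A _; apply: rank_leq_col.
have ex_bound : exists r, `[< bound r >] by exists n; apply/asboolP.
case: (ex_minnP ex_bound) => r /asboolP[k hk] r_min.
exists k => l le_kl u Uu.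
have [A UA rA] : exists2 A : 'M[K]_n, (forall i, U l (row i A)) & (r <= \rank A)%N.
  apply: contrapT => noA; case: (posnP r) => [r0|r_gt0].
    by apply: noA; exists 0; rewrite ?r0 // => i; rewrite row0.
  suff /asboolP/r_min : bound r.-1 by rewrite leqNgt prednK // leqnn.
  exists l => A UA; rewrite -ltnS prednK // ltnNge; apply/negP => rA.
  by apply: noA; exists A.
apply: (U_submx UA); apply: contrapT => /negP u_notin.
suff : (\rank A < \rank (col_mx A u))%N.
  have := hk <<col_mx A u>>%MS; rewrite genmxE => /(_ _)/leq_trans/(_ rA) le_r lt_r.
  suff : (\rank (col_mx A u) <= \rank A)%N by rewrite leqNgt lt_r.
  apply: le_r => i; apply: (@U_submx k _ (col_mx A u)); last first.
    by rewrite -(genmxE (col_mx A u)) row_sub.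
  move=> j; rewrite -(splitK j); case: (split j) => j' /=.
    by rewrite rowKu; apply: (U_le le_kl).
  by rewrite rowKd row_id.
have sA : (A <= col_mx A u)%MS by rewrite -addsmxE addsmxSl.
rewrite (ltn_leqif (mxrank_leqif_sup sA)); apply: contra u_notin => /(submx_trans _); apply.
by rewrite -addsmxE addsmxSr.
Qed.

End SubspaceChain.

Section BoundedPolynomials.
Variables (n : nat) (K : fieldType) (E : nat).
Local Notation B := 'X_{1..n < E}.

Definition mpoly_of_row (v : 'rV[K]_#|{: B}|) : {mpoly K[n]} :=
  \sum_(b : B) v 0 (enum_rank b) *: 'X_[b].

Definition row_of_mpoly (g : {mpoly K[n]}) : 'rV[K]_#|{: B}| :=
  \row_(i < #|{: B}|) g@_(enum_val i : B).

Lemma mpoly_of_rowD u v : mpoly_of_row (u + v) = mpoly_of_row u + mpoly_of_row v.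
Proof.
by rewrite /mpoly_of_row -big_split; apply: eq_bigr => b _; rewrite mxE scalerDl.
Qed.

Lemma mpoly_of_rowZ c u : mpoly_of_row (c *: u) = c *: mpoly_of_row u.
Proof.
by rewrite /mpoly_of_row scaler_sumr; apply: eq_bigr => b _; rewrite mxE scalerA.
Qed.

Lemma mpoly_of_row0 : mpoly_of_row 0 = 0.
Proof. by rewrite -(scale0r 0) mpoly_of_rowZ scale0r. Qed.

Lemma row_of_mpolyK g : (msize g <= E)%N -> mpoly_of_row (row_of_mpoly g) = g.
Proof.
move=> sg; rewrite [RHS](mpolywE sg); apply: eq_bigr => b _.
by rewrite mxE enum_rankK.
Qed.

End BoundedPolynomials.

(** Modulo [J] every polynomial is congruent to one of degree below [E], so a chain of ideals above
    [J] is determined by its traces on a finite-dimensional space. *)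
Lemma artinian_of_bounded (n : nat) (K : fieldType) (J : {mpoly K[n]} -> Prop) (E : nat) :
  is_ideal J ->
  (forall k h, (E <= k)%N -> h \is k.-homog -> J h) -> artinian_quotient J.
Proof.
move=> JP JE I II JI I_decr.
pose U k (v : 'rV[K]_#|{: 'X_{1..n < E}}|) := I k (mpoly_of_row v).
have [|k u v Uu Uv|k c u Uu|k u|k hk] := @subspace_chain_stationary K _ U.
- by move=> k; rewrite /U mpoly_of_row0; apply: ideal0.
- by rewrite /U mpoly_of_rowD; apply: idealD.
- by rewrite /U mpoly_of_rowZ; apply: idealZ.
- exact: I_decr.
have trunc g : exists v : 'rV[K]_#|{: 'X_{1..n < E}}|, J (g - mpoly_of_row v).
  elim/mpoly_lin_ind: g => [|g h [u Ju] [v Jv]|c a].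
  - by exists 0; rewrite mpoly_of_row0 subrr; apply: ideal0.
  - by exists (u + v); rewrite mpoly_of_rowD opprD addrACA; apply: idealD.
  have [lt_a|le_a] := ltnP (mdeg a) E.
    exists (row_of_mpoly E (c *: 'X_[a])); rewrite row_of_mpolyK ?subrr; first exact: ideal0.
    by apply: leq_trans (msizeZ_le _ _) _; rewrite msizeX.
  exists 0; rewrite mpoly_of_row0 subr0; apply: idealZ => //.
  by apply: (JE (mdeg a)) => //; rewrite dhomogX.
exists k => l le_kl g Ig; have [v Jv] := trunc g.
rewrite -[g](subrK (mpoly_of_row v)); apply: idealD => //; first exact: JI.
apply: (hk l le_kl); rewrite /U.
rewrite (_ : mpoly_of_row v = g - (g - mpoly_of_row v)); last by rewrite opprB addrC subrK.
by apply: idealB => //; apply: JI.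
Qed.

(* Artinian Gorenstein ideals with a homogeneous socle generator w of
   degree e, described degree by degree. *)
Definition graded_gorenstein (n : nat) (K : fieldType) (J : {mpoly K[n]} -> Prop)
    (e : nat) (w : {mpoly K[n]}) : Prop :=
  [/\ is_ideal J /\ homogeneous J,
      [/\ w \is e.-homog, ~ J w & forall g, g \is e.-homog -> exists c, J (g - c *: w)],
      forall k h, (e < k)%N -> h \is k.-homog -> J h
    & forall k g, g \is k.-homog -> (k <= e)%N ->
        (forall h, h \is (e - k).-homog -> J (h * g)) -> J g].

Section GradedGorenstein.
Variables (n : nat) (K : fieldType) (J : {mpoly K[n]} -> Prop) (e : nat).
Variable (w : {mpoly K[n]}).
Hypothesis hJ : graded_gorenstein J e w.

Let JP : is_ideal J. Proof. by case: hJ => -[]. Qed.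
Let hJh : homogeneous J. Proof. by case: hJ => -[]. Qed.
Let hw : w \is e.-homog. Proof. by case: hJ => _ []. Qed.
Let Jw : ~ J w. Proof. by case: hJ => _ []. Qed.
Let top : forall g, g \is e.-homog -> exists c, J (g - c *: w).
Proof. by case: hJ => _ []. Qed.
Let above : forall k h, (e < k)%N -> h \is k.-homog -> J h. Proof. by case: hJ. Qed.
Let pairing : forall k g, g \is k.-homog -> (k <= e)%N ->
  (forall h, h \is (e - k).-homog -> J (h * g)) -> J g.
Proof. by case: hJ. Qed.

Lemma graded_socle : in_socle J w.
Proof.
by move=> i; apply: (above (ltnSn e)); rewrite -[e.+1]add1n dhomogM ?dhomogXU.
Qed.

(** Above [e] everything is in [J]. Below [e], a socle form is annihilated by all forms of the
    positive degree [e - k], so the perfect pairing kills it. *)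
Lemma graded_socle_components h k : in_socle J h -> k != e -> J (pihomog mdeg k h).
Proof.
move=> sh ne; have hk := pihomogP mdeg k h.
have [lt_ek|lt_ke|E] := ltngtP e k; last by rewrite E eqxx in ne.
  exact: above lt_ek hk.
apply: (pairing hk (ltnW lt_ke)) => p hp.
have sk : in_socle J (pihomog mdeg k h).
  by move=> i; rewrite mulrC -(pihomogM_hom _ _ (dhomogXU _ i)) mulrC; apply: hJh.
by apply: (in_socle_mul JP hp) => //; rewrite subn_gt0.
Qed.

Lemma graded_socle_dim1 : forall h, in_socle J h -> exists c, J (h - c *: w).
Proof.
move=> h sh; have [c Jc] := top (pihomogP mdeg e h); exists c.
apply: ideal_components => // k; rewrite raddfB /= linearZ /=.
have [->|ne] := eqVneq k e; first by rewrite (pihomog_dE hw).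
rewrite (pihomog_ne0 _ hw) 1?eq_sym // scaler0 subr0.
exact: graded_socle_components.
Qed.

Lemma graded_artinian_gorenstein : artinian_gorenstein J.
Proof.
split=> //; first exact: (@artinian_of_bounded _ _ _ e.+1).
by exists w; split; [exact: graded_socle | | exact: graded_socle_dim1].
Qed.

Lemma graded_socle_degree d : socle_degree J d -> d = e.
Proof.
move=> [g [hg sg Jg]]; apply/eqP; apply: contrapT => /negP ne; apply: Jg.
by rewrite -(pihomog_dE hg); apply: graded_socle_components.
Qed.

Lemma graded_socle_degreeE : socle_degree J e.
Proof. by exists w; split=> //; exact: graded_socle. Qed.

End GradedGorenstein.

(** * Apolarity *)

Section Apolarity.
Variables (n : nat) (K : numFieldType).
Local Notation T := {mpoly K[n]}.
Implicit Types (D F : T) (a b : 'X_{1..n}).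

Lemma diff_actE l D F : (msize D <= l)%N ->
  diff_act D F = \sum_(a : 'X_{1..n < l}) D@_a *: F^`M[a].
Proof.
move=> le_l; set I : subFinType _ := 'X_{1..n < l}.
rewrite /diff_act (big_mksub I) ?msupp_uniq //=; first last.
  by move=> x /msize_mdeg_lt /leq_trans; apply.
by rewrite big_rmcond //= => j /memN_msupp_eq0 ->; rewrite scale0r.
Qed.

Lemma diff_actD D D' F : diff_act (D + D') F = diff_act D F + diff_act D' F.
Proof.
pose l := maxn (msize (D + D')) (maxn (msize D) (msize D')).
rewrite !(@diff_actE l) ?leq_max ?leqnn ?orbT // -big_split.
by apply: eq_bigr => a _; rewrite mcoeffD scalerDl.
Qed.

Lemma diff_actZX c a F : diff_act (c *: 'X_[a]) F = c *: F^`M[a].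
Proof.
have [->|c0] := eqVneq c 0; first by rewrite !scale0r /diff_act msupp0 big_nil.
by rewrite /diff_act msuppMCX // big_seq1 mcoeffZ mcoeffX eqxx mulr1.
Qed.

Lemma diff_actX a F : diff_act 'X_[a] F = F^`M[a].
Proof. by rewrite -['X_[a]]scale1r diff_actZX scale1r. Qed.

Lemma diff_act0 F : diff_act 0 F = 0.
Proof. by rewrite /diff_act msupp0 big_nil. Qed.

Lemma diff_actZ c D F : diff_act (c *: D) F = c *: diff_act D F.
Proof.
elim/mpoly_lin_ind: D => [|D D' IH IH'|d a]; first by rewrite !(scaler0, diff_act0).
  by rewrite scalerDr !diff_actD IH IH' scalerDr.
by rewrite scalerA !diff_actZX scalerA.
Qed.

Lemma diff_act_sum (I : Type) (r : seq I) (P : pred I) (D : I -> T) F :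
  diff_act (\sum_(i <- r | P i) D i) F = \sum_(i <- r | P i) diff_act (D i) F.
Proof.
by elim/big_rec2: _ => [|i x y _ <-]; rewrite ?diff_act0 ?diff_actD.
Qed.

Lemma diff_actZr c D F : diff_act D (c *: F) = c *: diff_act D F.
Proof.
rewrite /diff_act scaler_sumr; apply: eq_bigr => a _.
by rewrite mderivmZ !scalerA mulrC.
Qed.

Lemma diff_act0r D : diff_act D 0 = 0.
Proof. by rewrite -{1}(scale0r (0 : T)) diff_actZr scale0r. Qed.

Lemma diff_actM D D' F : diff_act (D * D') F = diff_act D (diff_act D' F).
Proof.
elim/mpoly_lin_ind: D => [|D1 D2 IH1 IH2|c a]; first by rewrite mul0r !diff_act0.
  by rewrite mulrDl !diff_actD IH1 IH2.
rewrite -scalerAl !diff_actZ diff_actX; congr (_ *: _).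
elim/mpoly_lin_ind: D' => [|D1 D2 IH1 IH2|d b].
- by rewrite mulr0 !diff_act0 raddf0.
- by rewrite mulrDr !diff_actD IH1 IH2 raddfD.
by rewrite -scalerAr -mpolyXD !diff_actZX mderivmZ addmC mderivmDm.
Qed.

Lemma mderivm_homog (e : nat) F a : F \is e.-homog -> F^`M[a] \is (e - mdeg a).-homog.
Proof.
elim/dhomog_lin_ind => [|F1 F2|c b <-]; first by rewrite raddf0 rpred0.
  by rewrite raddfD; apply: rpredD.
rewrite mderivmZ mderivmX rpredZ //.
have [le_ab|/forallPn[i lt_i]] := boolP (a <= b)%MM; last first.
  by rewrite (bigD1 i) //= ffact_small ?mul0n ?scale0r ?rpred0 // ltnNge.
by rewrite rpredZ // dhomogX /= -{2}(submK le_ab) mdegD addnK.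
Qed.

Lemma mderivm_eq0 (e : nat) F a : F \is e.-homog -> (e < mdeg a)%N -> F^`M[a] = 0.
Proof.
elim/dhomog_lin_ind => [|F1 F2 IH1 IH2 h|c b <- lt_ba]; first by rewrite raddf0.
  by rewrite raddfD /= IH1 ?IH2 ?addr0.
rewrite mderivmZ mderivmX.
have /forallPn[i lt_i] : ~~ (a <= b)%MM.
  by apply: contraTN lt_ba => /submK <-; rewrite mdegD -leqNgt leq_addl.
by rewrite (bigD1 i) //= ffact_small ?mul0n ?scale0r ?scaler0 // ltnNge.
Qed.

Lemma diff_act_homog (d e : nat) D F : D \is d.-homog -> F \is e.-homog ->
  diff_act D F \is (e - d).-homog.
Proof.
move=> hD hF; elim/dhomog_lin_ind: hD => [|D1 D2|c a <-].
- by rewrite diff_act0 rpred0.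
- by rewrite diff_actD; apply: rpredD.
by rewrite diff_actZX rpredZ // mderivm_homog.
Qed.

Lemma diff_act_eq0 (d e : nat) D F : D \is d.-homog -> F \is e.-homog ->
  (e < d)%N -> diff_act D F = 0.
Proof.
move=> hD hF lt_ed; elim/dhomog_lin_ind: hD => [|D1 D2 IH1 IH2|c a Ea].
- by rewrite diff_act0.
- by rewrite diff_actD IH1 IH2 addr0.
by rewrite diff_actZX (mderivm_eq0 hF) ?Ea ?scaler0.
Qed.

Definition mfact a : nat := (\prod_i (a i)`!)%N.

Lemma mfact_neq0 a : (mfact a)%:R != 0 :> K.
Proof. by rewrite pnatr_eq0 -lt0n prodn_gt0 // => i; rewrite fact_gt0. Qed.

Lemma dhomog0E F : F \is 0.-homog -> F = (F@_0)%:MP.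
Proof.
elim/dhomog_lin_ind => [|F1 F2 E1 E2|c a /eqP].
- by rewrite mcoeff0 mpolyC0.
- by rewrite {1}E1 {1}E2 mcoeffD mpolyCD.
rewrite mdeg_eq0 => /eqP ->.
by rewrite mpolyX0 mcoeffZ mcoeff1 eqxx mulr1 -mul_mpolyC mulr1.
Qed.

Lemma mderivm_top F a : F \is (mdeg a).-homog -> F^`M[a] = (F@_a *+ mfact a)%:MP.
Proof.
move/(mderivm_homog a); rewrite subnn => /dhomog0E ->; congr _%:MP.
rewrite mcoeff_mderivm addm0; congr (_ *+ _).
by apply: eq_bigr => i _; rewrite ffactnn.
Qed.

(** In characteristic zero the derivative along [a] recovers the coefficient at [a] up to the
    nonzero factor [mfact a]. *)
Lemma apolar_eq0 (e : nat) F : F \is e.-homog ->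
  (forall a, mdeg a = e -> F^`M[a] = 0) -> F = 0.
Proof.
move=> hF F0; apply/mpolyP => a; rewrite mcoeff0.
have [Ea|ne] := eqVneq (mdeg a) e; last exact: dhomog_nemf_coeff hF ne.
have hFa : F \is (mdeg a).-homog by rewrite Ea.
have := F0 a Ea; rewrite mderivm_top // => /eqP.
rewrite mpolyC_eq0 -mulr_natr mulf_eq0 (negPf (mfact_neq0 a)) orbF.
by move/eqP.
Qed.

Definition linear_power (p : 'I_n -> K) : T := \sum_i p i *: 'X_i.

Lemma linear_power_homog p : linear_power p \is 1.-homog.
Proof. by apply: rpred_sum => i _; rewrite rpredZ ?dhomogXU. Qed.

Lemma mderiv_linear_power p i e :
  (linear_power p ^+ e)^`M(i) = (p i *+ e) *: linear_power p ^+ e.-1.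
Proof.
have d1 : (linear_power p)^`M(i) = (p i)%:MP.
  rewrite raddf_sum /= (bigD1 i) //= big1 => [|j ne].
    rewrite mderivZ mderivX mnm1E eqxx scale1r addr0 (_ : (_ - _)%MM = 0%MM).
      by rewrite mpolyX0 -mul_mpolyC mulr1.
    by apply/mnmP => k; rewrite mnmBE subnn mnm0E.
  by rewrite mderivZ mderivX mnm1E (negPf ne) scale0r scaler0.
elim: e => [|e IH]; first by rewrite expr0 -mpolyC1 mderivC mulr0n scale0r.
rewrite exprS mderivM d1 IH mul_mpolyC -scalerAr /=.
case: e {IH} => [|e]; first by rewrite mulr0n scale0r addr0 mulr1n.
by rewrite -exprS -scalerDl -mulrS.
Qed.

Lemma mderivm_linear_power p e a : (mdeg a <= e)%N ->
  (linear_power p ^+ e)^`M[a] =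
  ((\prod_i p i ^+ a i) *+ (e ^_ (mdeg a))) *: linear_power p ^+ (e - mdeg a).
Proof.
have [k] := ubnP (mdeg a); elim: k a => // k IH a lt_k le_e.
have [->|a0] := eqVneq a 0%MM.
  rewrite mderivm0m mdeg0 subn0 ffactn0 big1 ?mulr1n ?scale1r // => i _.
  by rewrite mnm0E expr0.
have [i ai] : exists i, (0 < a i)%N.
  apply/existsP; apply: contraR a0 => /existsPn h; apply/eqP/mnmP => i.
  by rewrite mnm0E; apply/eqP; rewrite -leqn0 leqNgt h.
have le_Ui : (U_(i) <= a)%MM.
  by apply/mnm_lepP => j; rewrite mnm1E; case: eqP => // <-.
move: lt_k le_e {a0 ai}; rewrite -(submK le_Ui); move: (a - U_(i))%MM => b.
rewrite mdegD mdeg1 addn1 => lt_k le_e.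
rewrite mderivmDm mderivmU1m IH ?mderivZ ?mderiv_linear_power //; last exact: ltnW.
rewrite scalerA subnS; congr (_ *: _).
rewrite ffactnSr mulrnAr mulrnAl -mulrnA; congr (_ *+ _).
rewrite (bigD1 i) //= [RHS](bigD1 i) //= mnmDE mnm1E eqxx addn1 exprSr.
rewrite mulrAC; congr (_ * _); apply: eq_bigr => j ne.
by rewrite mnmDE mnm1E eq_sym (negPf ne) addn0.
Qed.

(** Up to the factorial this is the value at [p] of the monomial with exponent [a], so
    differentiating the power is evaluating at [p]. *)
Lemma mderivm_linear_power_top p a :
  (linear_power p ^+ mdeg a)^`M[a] = (\prod_i p i ^+ a i *+ (mdeg a)`!)%:MP.
Proof.
by rewrite mderivm_linear_power // subnn expr0 ffactnn -mul_mpolyC mulr1.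
Qed.

End Apolarity.

(** Duality: [l] annihilates the left kernel of [E], and the annihilator of that kernel is the
    column space. *)
Lemma linear_functional_span (K : fieldType) (n p : nat) (E : 'M[K]_(n, p)) (l : 'cV[K]_n) :
  (forall v : 'rV_n, v *m E = 0 -> v *m l = 0) -> exists c, l = E *m c.
Proof.
move=> hE; suff /submxP[c Ec] : (l^T <= E^T)%MS.
  by exists c^T; rewrite -[l]trmxK Ec trmx_mul trmxK.
rewrite submxE -[cokermx _]trmxK -trmx_mul -trmx0; apply/eqP; congr _^T.
have CE : (cokermx E^T)^T *m E = 0.
  by rewrite -[E in _ *m E]trmxK -trmx_mul mulmx_coker trmx0.
apply/row_matrixP => i; rewrite row_mul row0; apply: hE.
by rewrite -row_mul CE row0.
Qed.

Section EvaluationSpan.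
Variables (K : fieldType) (n p e : nat) (pts : 'I_p -> 'I_n -> K).
Variable Lam : {mpoly K[n]} -> K.
Hypothesis LamD : forall g h, Lam (g + h) = Lam g + Lam h.
Hypothesis LamZ : forall c g, Lam (c *: g) = c * Lam g.
Hypothesis Lam_pts : forall g, g \is e.-homog ->
  (forall j, g.@[pts j] = 0) -> Lam g = 0.

Lemma functional_evaluations :
  exists c : 'I_p -> K, forall g, g \is e.-homog -> Lam g = \sum_j c j * g.@[pts j].
Proof.
pose B := {: 'X_{1..n < e.+1}}; pose mono (b : B) := pihomog mdeg e ('X_[b] : {mpoly K[n]}).
have Lam0 : Lam 0 = 0 by rewrite -(scale0r 0) LamZ mul0r.
have Lam_sum (v : B -> K) : Lam (\sum_b v b *: mono b) = \sum_b v b * Lam (mono b).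
  by elim/big_rec2: _ => // b x y _ <-; rewrite LamD LamZ.
pose E : 'M[K]_(#|B|, p) := \matrix_(i, j) (mono (enum_val i)).@[pts j].
pose l : 'cV[K]_#|B| := \col_i Lam (mono (enum_val i)).
have [|c Ec] := @linear_functional_span K _ _ E l.
  move=> v vE; pose g := \sum_b v 0 (enum_rank b) *: mono b.
  suff Lg : Lam g = 0.
    apply/rowP => k; rewrite [k]ord1 mxE [RHS]mxE -[RHS]Lg Lam_sum.
    rewrite (reindex enum_rank) /=; last exact/onW_bij/enum_rank_bij.
    by apply: eq_bigr => b _; rewrite mxE enum_rankK.
  apply: Lam_pts; first by apply: rpred_sum => b _; rewrite rpredZ ?pihomogP.
  move=> j; have /rowP/(_ j) := vE; rewrite mxE [in X in _ = X]mxE => <-.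
  rewrite (reindex enum_rank) /=; last exact/onW_bij/enum_rank_bij.
  rewrite raddf_sum; apply: eq_bigr => b _ /=.
  by rewrite mevalZ mxE enum_rankK.
exists (fun j => c j 0) => g hg.
have Eg : g = \sum_(b : B) g@_b *: mono b.
  rewrite -[LHS](pihomog_dE hg) [X in pihomog _ _ X](@mpolywE _ _ e.+1 g); last first.
    rewrite msizeE; apply/bigmax_leqP_seq => a ag _.
    by move/dhomogP: hg => /(_ a ag) /= ->.
  by rewrite raddf_sum; apply: eq_bigr => b _; rewrite /= linearZ.
rewrite {1}Eg Lam_sum.
transitivity (\sum_(b : B) g@_b * \sum_j (mono b).@[pts j] * c j 0).
  apply: eq_bigr => b _; congr (_ * _).
  have /colP/(_ (enum_rank b)) := Ec; rewrite !mxE enum_rankK => ->.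
  by apply: eq_bigr => j _; rewrite mxE enum_rankK.
under eq_bigr do rewrite mulr_sumr.
rewrite exchange_big /=; apply: eq_bigr => j _.
rewrite {2}Eg raddf_sum mulr_sumr; apply: eq_bigr => b _ /=.
by rewrite mevalZ mulrA mulrC.
Qed.

End EvaluationSpan.

(** * Existence of the Macaulay polynomial and its Waring decomposition *)

Section MacaulayPolynomial.
Variables (K : numFieldType) (n k e : nat) (J : {mpoly K[n]} -> Prop).
Variables (w e1 e2 : {mpoly K[n]}) (L : n.-tuple {mpoly K[k]}).
Hypothesis hJ : graded_gorenstein J e w.
Hypotheses (Je1 : J e1) (Je2 : J e2) (hL : quotient_coords e1 e2 L).

Let JP : is_ideal J. Proof. by case: hJ => -[]. Qed.
Let hJh : homogeneous J. Proof. by case: hJ => -[]. Qed.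
Let hw : w \is e.-homog. Proof. by case: hJ => _ []. Qed.
Let Jw : ~ J w. Proof. by case: hJ => _ []. Qed.

Let L_homog i : tnth L i \is 1.-homog. Proof. by case: hL. Qed.

Let kerL g : g \mPo L = 0 -> J g.
Proof.
case: hL => _ _ ker /ker[u [v ->]].
by apply: idealD => //; apply: idealM.
Qed.

Let comp_homog (d : nat) g : g \is d.-homog -> g \mPo L \is d.-homog.
Proof. by move/(dhomog_comp L_homog); rewrite mul1n. Qed.

Let lift (d : nat) (D : {mpoly K[k]}) : D \is d.-homog ->
  exists2 g, g \is d.-homog & g \mPo L = D.
Proof.
move=> hD; case: hL => _ /(_ D)[g Eg] _; exists (pihomog mdeg d g).
  exact: pihomogP.
by have := pihomog_comp L_homog d g isT; rewrite mul1n Eg (pihomog_dE hD).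
Qed.

(** Here [phi] is the socle coordinate in degree [e], and [F] is built so that forms of degree [e]
    act on it through [phi]. For a form of degree at most [e], lying in [J] and killing [F] then
    both say that [phi] vanishes on all its multiples of degree [e]. *)
Lemma macaulay_polynomial_exists : exists F, macaulay_polynomial J L F.
Proof.
have [phi hphi] : exists phi : {mpoly K[n]} -> K, forall g, g \is e.-homog -> J (g - phi g *: w).
  have [g|phi hphi] := @choice _ _ (fun g c => g \is e.-homog -> J (g - c *: w)).
    have [hg|_] := boolP (g \is e.-homog); last by exists 0.
    by case: hJ => _ [_ _ /(_ g hg)[c Jc]] _ _; exists c.
  by exists phi.
have phi_uniq g c : g \is e.-homog -> J (g - c *: w) -> phi g = c.
  move=> hg Jc; apply/eqP; rewrite -subr_eq0; apply/eqP; apply: contrapT => /eqP ne.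
  apply: Jw; rewrite -[w](scalerK ne); apply: idealZ => //.
  have -> : (phi g - c) *: w = (g - c *: w) - (g - phi g *: w).
    by rewrite scalerBl opprB [RHS]addrC addrA subrK.
  by apply: idealB => //; apply: hphi.
have phi0 g : g \is e.-homog -> J g -> phi g = 0.
  by move=> hg Jg; apply: phi_uniq => //; rewrite scale0r subr0.
have [G hG] : exists G : 'X_{1..k} -> {mpoly K[n]},
    forall a, G a \is (mdeg a).-homog /\ G a \mPo L = 'X_[a].
  have [a|G hG] := @choice _ _ (fun a g => g \is (mdeg a).-homog /\ g \mPo L = 'X_[a]).
    have hXa : ('X_[a] : {mpoly K[k]}) \is (mdeg a).-homog by rewrite dhomogX.
    by have [g hg Eg] := lift hXa; exists g.
  by exists G.
(* [G a] lifts the monomial [a]; dividing by [mfact a] compensates the factorials produced by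
   differentiation. *)
pose F : {mpoly K[k]} :=
  \sum_(a : 'X_{1..k < e.+1} | mdeg a == e) (phi (G a) / (mfact a)%:R) *: 'X_[a].
have hF : F \is e.-homog.
  by apply: rpred_sum => a Ea; rewrite rpredZ // dhomogX.
have F_coef a : mdeg a = e -> F@_a = phi (G a) / (mfact a)%:R.
  move=> Ea; have lt_a : (mdeg a < e.+1)%N by rewrite Ea.
  rewrite raddf_sum (bigD1 (BMultinom lt_a)) ?Ea //= big1 => [|b /andP[_ ne]].
    by rewrite mcoeffZ mcoeffX eqxx mulr1 addr0.
  rewrite mcoeffZ mcoeffX; case: eqP => [E|]; last by rewrite mulr0.
  by case/eqP: ne; apply: val_inj.
have top g : g \is e.-homog -> diff_act (g \mPo L) F = (phi g)%:MP.
  move=> hg; have hD := comp_homog hg.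
  set D := g \mPo L in hD *.
  have ED : D = \sum_(a <- msupp D) D@_a *: 'X_[a] by apply: mpolyE.
  have -> : phi g = \sum_(a <- msupp D) D@_a * phi (G a).
    have degD a : a \in msupp D -> mdeg a = e by move/dhomogP: hD => /(_ a).
    apply: phi_uniq => //.
    rewrite -(subrK (\sum_(a <- msupp D) D@_a *: G a) g) -addrA; apply: idealD => //.
      apply: kerL; rewrite rmorphB /= -/D {1}ED [X in _ - X]raddf_sum /=.
      apply/eqP; rewrite subr_eq0; apply/eqP; apply: eq_bigr => a _.
      by rewrite comp_mpolyZ (hG a).2.
    rewrite scaler_suml -sumrB big_seq; apply: ideal_sum => // a /degD Ea.
    rewrite -scalerA -scalerBr; apply: idealZ => //; apply: hphi.
    by rewrite -Ea (hG a).1.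
  rewrite /diff_act rmorph_sum big_seq [RHS]big_seq; apply: eq_bigr => a aD /=.
  have Ea : mdeg a = e by move/dhomogP: hD => /(_ a aD).
  rewrite mderivm_top ?Ea // F_coef // -[_ / _ *+ _]mulr_natr divfK ?mfact_neq0 //.
  by rewrite mpolyCM mul_mpolyC.
have pair (d : nat) g : g \is d.-homog -> (d <= e)%N ->
    (forall g', g' \is (e - d).-homog -> phi (g' * g) = 0) <-> diff_act (g \mPo L) F = 0.
  move=> hg le_de; have hH := diff_act_homog (comp_homog hg) hF.
  have act g' : g' \is (e - d).-homog ->
      diff_act (g' \mPo L) (diff_act (g \mPo L) F) = (phi (g' * g))%:MP.
    by move=> hg'; rewrite -diff_actM -rmorphM /= top // -(subnK le_de) dhomogM.
  split=> [h0|H0 g' hg'].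
    apply: (apolar_eq0 hH) => a Ea; rewrite -diff_actX.
    by rewrite -(hG a).2 act ?h0 ?mpolyC0 // -Ea (hG a).1.
  by apply/eqP; rewrite -(mpolyC_eq0 k) -act // H0 diff_act0r.
have split_act g : diff_act (g \mPo L) F =
    \sum_(i < msize g) diff_act (pihomog mdeg i g \mPo L) F.
  by rewrite {1}[g]eq_sum_pihomog raddf_sum diff_act_sum.
exists F; split.
- apply/eqP => F0; apply: Jw; have := top w hw.
  rewrite F0 diff_act0r => /esym/eqP; rewrite mpolyC_eq0 => /eqP E.
  by have := hphi w hw; rewrite E scale0r subr0.
- by exists e => //; apply: graded_socle_degreeE hJ.
move=> g; split=> [Jg|Fg].
  rewrite split_act big1 // => d _.
  have hd := pihomogP mdeg d g.
  have [le_de|lt_ed] := leqP d e; last exact: diff_act_eq0 (comp_homog hd) hF lt_ed.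
  apply/(pair _ _ hd le_de) => g' hg'; apply: phi0.
    by rewrite -(subnK le_de) dhomogM.
  by apply: idealM => //; apply: hJh.
apply: ideal_components => // d; have hd := pihomogP mdeg d g.
have [le_de|lt_ed] := leqP d e; last by case: hJ => _ _ + _; apply; [exact: lt_ed|].
(* Components of degree at most [e] send [F] to different degrees and the others kill it, so each
   one annihilates [F]. *)
have Fd : diff_act (pihomog mdeg d g \mPo L) F = 0.
  have := congr1 (pihomog mdeg (e - d)) Fg; rewrite raddf0 (split_act g) raddf_sum /=.
  have comp i : pihomog mdeg (e - d) (diff_act (pihomog mdeg i g \mPo L) F) =
      if i == d then diff_act (pihomog mdeg d g \mPo L) F else 0.
    have hi := comp_homog (pihomogP mdeg i g).
    have [lt_ei|le_ie] := ltnP e i.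
      rewrite (diff_act_eq0 hi hF lt_ei) raddf0.
      by rewrite gtn_eqF // (leq_ltn_trans le_de).
    have hact := diff_act_homog hi hF.
    have [E|ne] := eqVneq i d; first by rewrite -E pihomog_dE.
    by rewrite (pihomog_ne0 _ hact) // eqn_sub2lE.
  have [lt_d|le_d] := ltnP d (msize g).
    rewrite (bigD1 (Ordinal lt_d)) //= comp eqxx big1 ?addr0 // => i ne.
    by rewrite comp; case: eqP => // E; case/eqP: ne; apply: val_inj.
  have -> : pihomog mdeg d g = 0.
    rewrite [g]eq_sum_pihomog raddf_sum big1 //= => i _.
    by rewrite (pihomog_ne0 _ (pihomogP mdeg i g)) // neq_ltn (leq_trans (ltn_ord i) le_d).
  by rewrite comp_mpoly0 diff_act0.
case: hJ => _ _ _ /(_ d _ hd le_de); apply=> g' hg'.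
have hgg : g' * pihomog mdeg d g \is e.-homog by rewrite -(subnK le_de) dhomogM.
have := hphi _ hgg; have /(pair _ _ hd le_de)/(_ g' hg') -> := Fd.
by rewrite scale0r subr0.
Qed.

Section Waring.
Variables (p : nat) (pts : 'I_p -> 'I_n -> K).
Hypothesis e_pts : forall j, e1.@[pts j] = 0 /\ e2.@[pts j] = 0.
Hypothesis J_pts : forall g, g \is e.-homog -> (forall j, g.@[pts j] = 0) -> J g.

Let kerL_pts j g : g \mPo L = 0 -> g.@[pts j] = 0.
Proof.
case: hL => _ _ ker /ker[u [v ->]]; have [z1 z2] := e_pts j.
by rewrite mevalD !mevalM z1 z2 !mulr0 addr0.
Qed.

(** A common zero of [e1] and [e2] is a point of the quotient ring by them, hence of the polynomial
    ring that [L] identifies with it. *)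
Lemma coordinates_of_point j : exists q : 'I_k -> K, forall g, (g \mPo L).@[q] = g.@[pts j].
Proof.
have [i|x hx] := @choice _ _ (fun (i : 'I_k) g => g \mPo L = 'X_i).
  by case: hL => _ /(_ 'X_i).
exists (fun i => (x i).@[pts j]) => g; rewrite comp_mpoly_meval; apply: meval_eq => i.
(* As [x] lifts the variables through [L], the polynomials [G] and ['X_i] agree after composition
   with [L]; their difference lies in [(e1, e2)] and vanishes at the point. *)
pose G := tnth L i \mPo [tuple x l | l < k].
have EG : G \mPo L = 'X_i \mPo L.
  apply/eqP; rewrite -subr_eq0; apply/eqP; apply: mpoly_eq0_meval => u.
  rewrite mevalB !comp_mpoly_meval mevalXU; apply/eqP; rewrite subr_eq0; apply/eqP.
  apply: meval_eq => l; rewrite tnth_mktuple -comp_mpoly_meval hx.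
  exact: mevalXU.
have /(kerL_pts j)/eqP : (G - 'X_i) \mPo L = 0 by rewrite rmorphB /= EG subrr.
rewrite mevalB mevalXU subr_eq0 => /eqP <-.
rewrite comp_mpoly_meval; apply: meval_eq => l.
by rewrite tnth_mktuple.
Qed.

Lemma macaulay_waring F : macaulay_polynomial J L F ->
  [/\ F != 0, F \is e.-homog & exists2 r, waring_number e F r & (r <= p)%N].
Proof.
move=> [F0 [d sd hF] FJ].
have {d sd hF} hF : F \is e.-homog by rewrite -(graded_socle_degree hJ sd).
split=> //.
have [q hq] := @choice _ _ (fun j q => forall g, (g \mPo L).@[q] = g.@[pts j]) coordinates_of_point.
(* On forms of degree [e] the action on [F] yields a constant, read off as the coefficient at 0;
   this functional kills [J], hence the forms vanishing at the points. *)
have [||g hg gpts|c hc] := @functional_evaluations K n p e pts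
    (fun g => (diff_act (g \mPo L) F)@_0).
- by move=> g h; rewrite rmorphD diff_actD mcoeffD.
- by move=> a g; rewrite comp_mpolyZ diff_actZ mcoeffZ.
- by have /FJ -> := J_pts hg gpts; rewrite mcoeff0.
(* The [e!] is the one produced by differentiating [e] times the [e]-th power of a linear form. *)
pose lam j := c j / (e`!)%:R.
have fact_neq0 : (e`!)%:R != 0 :> K by rewrite pnatr_eq0 -lt0n fact_gt0.
have EF : F = \sum_j lam j *: linear_power (q j) ^+ e.
  apply/eqP; rewrite -subr_eq0; apply/eqP; set F' := \sum_j _.
  have hF' : F' \is e.-homog.
    apply: rpred_sum => j _; rewrite rpredZ //.
    by have := dhomogMn e (linear_power_homog (q j)); rewrite mul1n.
  apply: (apolar_eq0 (rpredB hF hF')) => a Ea.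
  have hXa : ('X_[a] : {mpoly K[k]}) \is e.-homog by rewrite dhomogX; apply/eqP.
  have [g hg Eg] := lift hXa.
  have := hc g hg; rewrite Eg diff_actX => top.
  have := mderivm_homog a hF; rewrite Ea subnn => /dhomog0E EFa.
  have DF' : F'^`M[a] = \sum_j (lam j *: linear_power (q j) ^+ e)^`M[a].
    exact: raddf_sum.
  rewrite raddfB /= EFa top DF' rmorph_sum /= -sumrB big1 // => j _.
  rewrite -hq Eg mevalX mderivmZ -Ea mderivm_linear_power_top -mul_mpolyC -rmorphM /=.
  by rewrite /lam Ea -(mulr_natl (\prod_i _) e`!) mulrA divfK // subrr.
(* A Waring sum demands nonzero coefficients, so the other terms are dropped; at most [p] remain. *)
pose s := [seq j <- enum 'I_p | lam j != 0].
have Fs : is_waring_sum e F (size s).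
  exists (fun i => lam (tnth (in_tuple s) i)), (fun i => linear_power (q (tnth (in_tuple s) i))).
  split=> [i|i|]; last 1 first.
  - rewrite {1}EF -(big_tnth _ _ s xpredT (fun j => lam j *: linear_power (q j) ^+ e)).
    rewrite big_filter big_enum_cond /= [LHS](bigID (fun j => lam j == 0)) /= big1 ?add0r //.
    by move=> j /eqP ->; rewrite scale0r.
  - by have := mem_tnth i (in_tuple s); rewrite mem_filter => /andP[].
  - exact: linear_power_homog.
have ex_r : exists r, `[< is_waring_sum e F r >] by exists (size s); apply/asboolP.
case: (ex_minnP ex_r) => r /asboolP hr r_min; exists r.
  by split=> // r' /asboolP/r_min.
apply: leq_trans (r_min _ (asboolT Fs)) _.
by rewrite size_filter (leq_trans (count_size _ _)) // size_enum_ord.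
Qed.

End Waring.
End MacaulayPolynomial.

(** * Veronese pullback *)

Section BoundedSocle.
Variables (n : nat) (K : fieldType) (I : {mpoly K[n]} -> Prop) (d : nat).
Hypotheses (IP : is_ideal I) (I_homog : homogeneous I).
Hypothesis I_socle : socle_dim1_in_degree I d.
Hypothesis I_bounded : exists e, forall h k, (e <= k)%N -> h \is k.-homog -> I h.

(** Downward induction from the degrees where everything is in [I]: all ['X_i * h] are in [I], so
    [h] is a socle form of degree other than [d]. *)
Lemma ideal_above_socle k h : (d < k)%N -> h \is k.-homog -> I h.
Proof.
have [e he] := I_bounded; have [w [hw _ _ uw]] := I_socle.
have [r] := ubnP (e - k); elim: r k h => // r IH k h lt_r lt_dk hh.
have [le_e|lt_ke] := leqP e k; first exact: he hh.
have sh : in_socle I h.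
  move=> i; apply: (IH k.+1); [by rewrite subnS; lia | exact: ltnW |].
  by have := dhomogM (dhomogXU K i) hh.
have [c /(I_homog k)] := uw h sh.
rewrite raddfB /= linearZ /= pihomog_dE // (pihomog_ne0 _ hw) ?scaler0 ?subr0 //.
by rewrite ltn_eqF.
Qed.

Lemma ideal_top_socle : exists w, [/\ w \is d.-homog, ~ I w
  & forall h, h \is d.-homog -> exists c : K, I (h - c *: w)].
Proof.
have [w [hw _ Iw uw]] := I_socle; exists w; split=> // h hh.
apply: uw => i; apply: (ideal_above_socle (ltnSn d)).
by have := dhomogM (dhomogXU K i) hh.
Qed.

End BoundedSocle.

Lemma mnm_sub_degree (n : nat) (a : 'X_{1..n}) (m : nat) : (m <= mdeg a)%N ->
  exists2 b : 'X_{1..n}, (b <= a)%MM & mdeg b = m.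
Proof.
elim: m => [|m IH] le_m.
  by exists 0%MM; rewrite ?mdeg0 //; apply/mnm_lepP => i; rewrite mnm0E.
have [b le_ba Eb] := IH (ltnW le_m).
have [i lt_i] : exists i, (b i < a i)%N.
  apply/existsP; apply: contraTT le_m => /existsPn h; rewrite -leqNgt -Eb !mdegE.
  by apply: leq_sum => i _; rewrite leqNgt h.
exists (b + U_(i))%MM; last by rewrite mdegD mdeg1 Eb addn1.
apply/mnm_lepP => j; rewrite mnmDE mnm1E; case: eqP => [<-|_]; rewrite ?addn1 //.
by rewrite addn0; move/mnm_lepP: le_ba.
Qed.

Section Veronese.
Variables (K : numClosedFieldType) (m N s : nat) (f : {mpoly K[3]}).
Hypotheses (m_gt0 : (0 < m)%N) (N_monoms : N.+1 = size (monoms m)).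
Local Notation S := {mpoly K[3]}.
Local Notation Z := {mpoly K[N.+1]}.

Definition veronese_tuple : N.+1.-tuple S :=
  [tuple 'X_[nth 0%MM (monoms m) i] | i < N.+1].

Definition veronese_pullback (g : Z) : S := g \mPo veronese_tuple.
Local Notation psi := veronese_pullback.

Lemma veronese_tuple_homog i : tnth veronese_tuple i \is m.-homog.
Proof.
rewrite tnth_mktuple dhomogX /=.
by have := ltn_ord i; rewrite [X in (_ < X)%N]N_monoms => /(mem_nth 0%MM); rewrite mem_monoms.
Qed.

Lemma veronese_pullback_homog (k : nat) (g : Z) : g \is k.-homog -> psi g \is (m * k).-homog.
Proof. exact: (dhomog_comp veronese_tuple_homog). Qed.

Lemma pihomog_veronese_pullback (k : nat) (g : Z) :
  pihomog mdeg (m * k) (psi g) = psi (pihomog mdeg k g).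
Proof. exact: (pihomog_comp veronese_tuple_homog). Qed.

Lemma veronese_pullback_eval (g : Z) (p : 'rV[K]_3) :
  (psi g).@[p 0] = g.@[veronese N m p 0].
Proof.
rewrite comp_mpoly_meval; apply: meval_eq => i.
by rewrite tnth_mktuple mxE.
Qed.

(** A monomial of degree [m * k] is a product of [k] monomials of degree [m], each the image of a
    variable. *)
Lemma veronese_pullback_surj (k : nat) (q : S) : q \is (m * k).-homog ->
  exists2 g : Z, g \is k.-homog & psi g = q.
Proof.
elim/dhomog_lin_ind => [|q1 q2 [g1 h1 <-] [g2 h2 <-]|c a].
- by exists 0; rewrite ?rpred0 // /psi comp_mpoly0.
- by exists (g1 + g2); rewrite ?rpredD // /psi comp_mpolyD.
elim: k c a => [|k IH] c a.
  move/eqP; rewrite muln0 mdeg_eq0 => /eqP ->; exists c%:MP.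
    by rewrite -[c%:MP]mulr1 mul_mpolyC rpredZ ?dhomog1.
  by rewrite /psi comp_mpolyC mpolyX0 -mul_mpolyC mulr1.
rewrite mulnS => Ea; have [|b le_ba Eb] := @mnm_sub_degree _ a m; first by rewrite Ea leq_addr.
have [|g hg Eg] := IH c (a - b)%MM.
  by apply: (@addIn m); rewrite -{1}Eb -mdegD submK // Ea addnC.
have bm : b \in monoms m by rewrite mem_monoms Eb.
have lt_i : (index b (monoms m) < N.+1)%N by rewrite N_monoms index_mem.
exists (g * 'X_(Ordinal lt_i)).
  by have := dhomogM hg (dhomogXU K (Ordinal lt_i)); rewrite addn1.
rewrite /psi rmorphM /= -/(psi g) Eg comp_mpolyXU -tnth_nth tnth_mktuple nth_index //.
by rewrite -scalerAl -mpolyXD submK.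
Qed.

Variables (a b : 'rV[K]_N.+1).
Local Notation q1 := (form m (a 0)).
Local Notation q2 := (form m (b 0)).
Local Notation d := (s * m + 3)%N.
Hypothesis f_smooth : smooth_plane_curve d f.
Local Notation X := (@veronese_curve K N m f).
Local Notation J := (adjoin2 (homogeneous_ideal X) (linear_form a) (linear_form b)).
Let B := adjoin1 (adjoin1 (adjoin1 (@zero_ideal 3 K) q1) q2) f.

Let d_gt0 : (0 < d)%N. Proof. by rewrite addn3. Qed.
Let hf : f \is d.-homog. Proof. by case: f_smooth. Qed.
Let hq1 : q1 \is m.-homog. Proof. exact: form_homog. Qed.
Let hq2 : q2 \is m.-homog. Proof. exact: form_homog. Qed.

Let pihomog_mul (q g : S) (i e : nat) : q \is i.-homog ->
  exists u, pihomog mdeg e (g * q) = u * q.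
Proof.
move=> hq; have [lt_ei|/subnKC E] := ltnP e i.
  by exists 0; rewrite (pihomogM_lt _ hq) // mul0r.
by exists (pihomog mdeg (e - i) g); rewrite -{1}E (pihomogM_hom _ _ hq).
Qed.

Lemma veronese_linear_form (c : 'rV[K]_N.+1) : psi (linear_form c) = form m (c 0).
Proof.
rewrite /psi /linear_form raddf_sum; apply: eq_bigr => i _ /=.
by rewrite comp_mpolyZ comp_mpolyXU -tnth_nth tnth_mktuple.
Qed.

(** The component of degree [k] pulls back to the one of degree [m * k]; it vanishes on [X] exactly
    when its pullback vanishes on the plane curve, that is, when [f] divides the pullback. *)
Lemma homogeneous_idealP (g : Z) : homogeneous_ideal X g <-> exists u, psi g = u * f.
Proof.
split=> [Xg|[u Eu] k z [p [c [p0 fp c0 ->]]]].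
  have comp k : exists u, psi (pihomog mdeg k g) = u * f.
    apply: (smooth_curve_divides d_gt0 f_smooth).
      exact/veronese_pullback_homog/pihomogP.
    move=> p p0 fp; rewrite veronese_pullback_eval.
    apply: Xg; exists p, 1; split=> //; first exact: oner_neq0.
    by rewrite scale1r.
  have [u hu] := @choice _ _ (fun k u => psi (pihomog mdeg k g) = u * f) comp.
  exists (\sum_(k < msize g) u k); rewrite {1}[g]eq_sum_pihomog /psi raddf_sum mulr_suml.
  by apply: eq_bigr => k _; apply: hu.
have [v Ev] := pihomog_mul u (m * k) hf.
have -> : (pihomog mdeg k g).@[(c *: veronese N m p) 0] =
    c ^+ k * (pihomog mdeg k g).@[veronese N m p 0].
  rewrite -(meval_scale_homog _ _ (pihomogP mdeg k g)); apply: meval_eq => i.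
  by rewrite mxE.
rewrite -veronese_pullback_eval -pihomog_veronese_pullback Eu Ev.
by rewrite mevalM fp !mulr0.
Qed.

Lemma homogeneous_ideal_ideal : is_ideal (homogeneous_ideal X).
Proof.
split.
- by apply/homogeneous_idealP; exists 0; rewrite /psi comp_mpoly0 mul0r.
- move=> g h /homogeneous_idealP[u Eu] /homogeneous_idealP[v Ev].
  apply/homogeneous_idealP; exists (u + v).
  by rewrite /psi comp_mpolyD -/(psi g) -/(psi h) Eu Ev mulrDl.
move=> v g /homogeneous_idealP[u Eu]; apply/homogeneous_idealP; exists (psi v * u).
by rewrite /psi rmorphM /= -/(psi g) Eu mulrA.
Qed.

Lemma adjoin2_ideal : is_ideal J.
Proof.
have IX := homogeneous_ideal_ideal; split.
- by exists 0, 0, 0; rewrite !mul0r !addr0; split=> //; apply: (ideal0 IX).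
- move=> _ _ [h [u [v [Xh ->]]]] [h' [u' [v' [Xh' ->]]]].
  exists (h + h'), (u + u'), (v + v'); split; first exact: (idealD IX).
  by rewrite !mulrDl; ring.
move=> t _ [h [u [v [Xh ->]]]]; exists (t * h), (t * u), (t * v).
by split; [exact: (idealM _ IX) | ring].
Qed.

(** This embeds the quotient by [J] in the quotient by [B]. From [B] to [J], the cofactors of [q1]
    and [q2] in degree [m * k] have degree [m * (k - 1)], again a multiple of [m], so they are
    pullbacks. *)
Lemma veronese_idealP (g : Z) : J g <-> B (psi g).
Proof.
have JP := adjoin2_ideal.
split=> [[h [u [v [/homogeneous_idealP[w Ew] ->]]]]|[_ [w [[_ [v [[_ [u [-> ->]]] ->]]] Eg]]]].
  exists (psi u * q1 + psi v * q2), w; split.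
    by exists (psi u * q1), (psi v); split=> //; exists 0, (psi u); rewrite add0r.
  rewrite /psi !rmorphD !rmorphM /= -/(psi h) Ew -/(psi (linear_form a)).
  by rewrite -/(psi (linear_form b)) !veronese_linear_form; ring.
apply: (ideal_components JP) => k; rewrite add0r in Eg.
have /(congr1 (pihomog mdeg (m * k))) := Eg.
rewrite pihomog_veronese_pullback 2!raddfD /=.
have [w' ->] := pihomog_mul w (m * k) hf.
set gk := pihomog mdeg k g.
have pull (q : S) (c : 'rV[K]_N.+1) : exists t : Z,
    pihomog mdeg (m * k) (q * form m (c 0)) = psi (t * linear_form c).
  have hc : form m (c 0) \is m.-homog by apply: form_homog.
  (* In degree 0 a multiple of a form of positive degree [m] has no component. *)
  case: k {gk} => [|k].
    by exists 0; rewrite mul0r muln0 (pihomogM_lt _ hc) // /psi comp_mpoly0.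
  rewrite mulnS (pihomogM_hom _ _ hc).
  have [t _ <-] := veronese_pullback_surj (pihomogP mdeg (m * k) q).
  by exists t; rewrite /psi rmorphM /= -/(psi (linear_form c)) veronese_linear_form.
have [t1 ->] := pull u a; have [t2 ->] := pull v b => Ek.
exists (gk - t1 * linear_form a - t2 * linear_form b), t1, t2; split; last by ring.
apply/homogeneous_idealP; exists w'.
rewrite /psi !rmorphB /= -/(psi gk) Ek.
by rewrite -/(psi (t1 * _)) -/(psi (t2 * _)); ring.
Qed.

Hypothesis B_socle : socle_dim1_in_degree B (m + m + d - 3).
Hypothesis B_bounded : exists e, forall h k, (e <= k)%N -> h \is k.-homog -> B h.

Let B_ideal : is_ideal B.
Proof. by do 3!apply: adjoin1_ideal; apply: zero_idealP. Qed.

Let B_homog : homogeneous B.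
Proof.
apply: adjoin1_homogeneous hf; first by do 2!apply: adjoin1_ideal; apply: zero_idealP.
apply: adjoin1_homogeneous hq2; first by apply: adjoin1_ideal; apply: zero_idealP.
apply: adjoin1_homogeneous hq1; first exact: zero_idealP.
exact: zero_ideal_homogeneous.
Qed.

Let socleE : (m + m + d - 3 = m * (s + 2))%N.
Proof. by rewrite addnA addnK mulnDr mulnC; lia. Qed.

Lemma veronese_graded_gorenstein : exists w, graded_gorenstein J (s + 2) w.
Proof.
have [w0 [hw0 Bw0 top0]] := ideal_top_socle B_homog B_socle B_bounded.
rewrite socleE in hw0 top0.
have [w hw Ew] := veronese_pullback_surj hw0; exists w; split.
- split; first exact: adjoin2_ideal.
  move=> k g /veronese_idealP Bg; apply/veronese_idealP.
  by rewrite -pihomog_veronese_pullback; apply: B_homog.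
- split=> //; first by move/veronese_idealP; rewrite Ew.
  move=> g hg; have [c Bc] := top0 _ (veronese_pullback_homog hg); exists c.
  by apply/veronese_idealP; rewrite /psi rmorphB /= comp_mpolyZ -/(psi g) -/(psi w) Ew.
- move=> k h lt_k hh; apply/veronese_idealP.
  apply: (ideal_above_socle B_homog B_socle B_bounded _ (veronese_pullback_homog hh)).
  by rewrite socleE ltn_pmul2l.
move=> k g hg le_k hp; apply/veronese_idealP.
apply: (gorenstein_pairing B_ideal B_homog B_socle B_bounded (veronese_pullback_homog hg)).
  by rewrite socleE leq_pmul2l.
(* The complementary degree is again a multiple of [m], so every test form is a pullback: the
   perfect pairing restricts to the Veronese subring. *)
rewrite socleE -mulnBr => q /veronese_pullback_surj[h hh <-].
by have /veronese_idealP := hp h hh; rewrite /psi rmorphM.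
Qed.

End Veronese.

(** * From a good pair of plane curves to the curve in projective space *)

Section GoodPairs.
Variables (K : numClosedFieldType) (m N s : nat) (f : {mpoly K[3]}).
Hypotheses (m_gt0 : (0 < m)%N) (N_monoms : N.+1 = size (monoms m)).
Local Notation d := (s * m + 3)%N.
Hypothesis f_smooth : smooth_plane_curve d f.
Variables (a b : 'rV[K]_N.+1).
Local Notation q1 := (form m (a 0)).
Local Notation q2 := (form m (b 0)).
Hypothesis ab_good : good_pair m d f q1 q2.
Local Notation J := (adjoin2 (homogeneous_ideal (@veronese_curve K N m f))
  (linear_form a) (linear_form b)).

Lemma good_pair_gorenstein_points : exists (w : {mpoly K[N.+1]}) (p : nat)
    (pts : 'I_p -> 'I_N.+1 -> K),
  [/\ graded_gorenstein J (s + 2) w, (p <= m ^ 2)%N,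
      forall j, (linear_form a).@[pts j] = 0 /\ (linear_form b).@[pts j] = 0
    & forall g, g \is (s + 2).-homog -> (forall j, g.@[pts j] = 0) -> J g].
Proof.
have hf : f \is d.-homog by case: f_smooth.
have d_gt0 : (0 < d)%N by rewrite addn3.
have hq1 : q1 \is m.-homog by apply: form_homog.
have hq2 : q2 \is m.-homog by apply: form_homog.
have [q1v qinf] := ab_good; rewrite coprimepMr => /andP[rho_sep rho_tau].
have {}rho_sep : separable_poly (resultant_x m m q1 q2) by rewrite unlock.
have [r [mu [r_uniq r_size r_pts points_ideal]]] :=
  finite_point_set m_gt0 hq1 hq2 q1v qinf rho_sep.
have q_pts x : x \in r -> q1.@[point3 1 x (mu x)] = 0 /\ q2.@[point3 1 x (mu x)] = 0.
  by case/r_pts.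
have f_pts x : x \in r -> f.@[point3 1 x (mu x)] != 0.
  (* A zero of [f] at the point above [x] would make [x] a common root of the two resultants,
     against their coprimality. *)
  case/r_pts => rx q1x _; apply/eqP => fx.
  have /Pdiv.ClosedField.coprimepP/(_ x) := rho_tau.
  move/(_ (introT rootP rx))/negP; apply.
  by apply/(resultant_x_root x m_gt0 hq1 hf q1v); exists (mu x).
have [M X1M] := X1_nilpotent m_gt0 hq1 hq2 qinf.
have B_socle := points_curve_socle m_gt0 hq1 hq2 d_gt0 hf q_pts f_pts points_ideal q1v X1M.
have B_bounded := points_curve_artinian hf r_uniq f_pts points_ideal.
have [w hw] := veronese_graded_gorenstein m_gt0 N_monoms f_smooth B_socle B_bounded.
pose x (j : 'I_(size r)) := tnth (in_tuple r) j.
pose p j : 'rV[K]_3 := \row_i point3 1 (x j) (mu (x j)) i.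
pose pts j : 'I_N.+1 -> K := veronese N m (p j) 0.
have xr j : x j \in r := mem_tnth j (in_tuple r).
have pts_eval g j : g.@[pts j] = (veronese_pullback m g).@[point3 1 (x j) (mu (x j))].
  rewrite -veronese_pullback_eval; apply: meval_eq => i.
  by rewrite mxE.
exists w, (size r), pts; split=> // [j|g hg g_pts].
  rewrite !pts_eval !veronese_linear_form.
  exact: q_pts.
(* The pullback vanishes on the plane points, so it lies already in [(q1, q2)]. *)
apply/(veronese_idealP m_gt0 N_monoms a b f_smooth); apply: adjoin1_sub.
apply: (points_ideal _ _ (veronese_pullback_homog N_monoms hg)) => y yr.
have lt_y : (index y r < size r)%N by rewrite index_mem.
have := g_pts (Ordinal lt_y).
by rewrite pts_eval /x (tnth_nth 0) /= nth_index.
Qed.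

End GoodPairs.

Theorem theorem12 (R : realType) (s n : nat) (f : {mpoly R[i][3]})
    (hs : (2 <= s)%N) (hn : (2 <= n)%N)
    (hC : smooth_plane_curve (s * (n - 1) + 3) f) :
  let N := ('C(n.+1, 2) - 1)%N in
  let X := @veronese_curve R[i] N (n - 1) f in
  for_general_pair (fun eta1 eta2 : {mpoly R[i][N.+1]} =>
    let J := adjoin2 (homogeneous_ideal X) eta1 eta2 in
    artinian_gorenstein J /\
    forall L : N.+1.-tuple {mpoly R[i][N - 1]},
      quotient_coords eta1 eta2 L ->
      (exists F, macaulay_polynomial J L F) /\
      forall F, macaulay_polynomial J L F ->
        [/\ F != 0, F \is (s + 2).-homog
          & exists2 r, waring_number (s + 2) F r & (r <= (n - 1) ^ 2)%N]).
Proof.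
have m_gt0 : (0 < n - 1)%N by rewrite subn_gt0.
have En : (n.+1 = (n - 1).+2)%N by rewrite subn1 prednK // ltnW.
move=> N X.
(* The truncated subtraction in [N] is harmless, the binomial coefficient being positive. *)
have EN : N.+1 = size (monoms (n - 1)).
  by rewrite size_monoms -En /N subn1 prednK // bin_gt0 ltnS ltnW.
have [_ hf] := conj I (proj1 hC).
have [G G0 hG] :=
  general_good_pair m_gt0 EN hf (smooth_plane_curve_neq0 hC).
exists G => // a b /hG ab_good J.
have [w [p [pts [hJ le_p e_pts J_pts]]]] :=
  good_pair_gorenstein_points m_gt0 EN hC ab_good.
have JP : is_ideal J := adjoin2_ideal m_gt0 EN a b hC.
have X0 : homogeneous_ideal X 0 by move=> k z _; rewrite raddf0 meval0.
have Ja : J (linear_form a) by exists 0, 1, 0; split=> //; ring.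
have Jb : J (linear_form b) by exists 0, 0, 1; split=> //; ring.
split; first exact: graded_artinian_gorenstein hJ.
move=> L hL; split; first exact: macaulay_polynomial_exists hJ Ja Jb hL.
move=> F /(macaulay_waring hJ hL e_pts J_pts)[F0 hF [r hr le_r]].
by split=> //; exists r => //; apply: leq_trans le_r le_p.
Qed.
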